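(* Let $\Bbbk$ be a field and let $B$ be a $\Bbbk$-bialgebra which is finite-dimensional or, more generally, right perfect (as an algebra). Consider the map $i_B\colon B\to B\oslash B$, $b\mapsto \overline{b\otimes 1}$. Then $\mathrm{H}(B)=\dfrac{B}{\ker(i_B)}\cong \mathrm{im}(i_B)$; that is, $B/\ker(i_B)$ is a quotient bialgebra of $B$ which is a Hopf algebra, and together with the canonical projection $B\to B/\ker(i_B)$ it is the Hopf envelope of $B$.
   Context: For a bialgebra $B$ over a field $\Bbbk$ with counit $\varepsilon$, put $B^+=\ker(\varepsilon)$ and $B\oslash B:=(B\otimes B)/\big((B\otimes B)\Delta(B^+)\big)$; the class of $x\otimes y$ is denoted $\overline{x\otimes y}=x\oslash y$. $B\oslash B$ is a coalgebra with $\Delta(x\oslash y)=(x_1\oslash y_2)\otimes(x_2\oslash y_1)$ and $\varepsilon(x\oslash y)=\varepsilon(x)\varepsilon(y)$, and $i_B$ is a coalgebra map. An algebra is right perfect if it satisfies the descending chain condition on principal left ideals. The Hopf envelope (free Hopf algebra generated by $B$) is a Hopf algebra $\mathrm{H}(B)$ with a bialgebra map $\eta_B\colon B\to\mathrm{H}(B)$ such that for every Hopf algebra $H$ and every bialgebra map $f\colon B\to H$ there is a unique Hopf algebra map $g\colon\mathrm{H}(B)\to H$ with $g\circ\eta_B=f$. *)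

(* Defs.v *)
From HB Require Import structures.
From mathcomp Require Import all_boot all_algebra generic_quotient.
From mathcomp Require Import boolp classical_sets.
From mathcomp Require Import freeg.

Set Implicit Arguments.
Unset Strict Implicit.
Unset Printing Implicit Defensive.

Import GRing.Theory.
Local Open Scope ring_scope.
Local Open Scope quotient_scope.

(* V / I for a subspace I of V. The quotient (and likewise the tensor product  *)
(* below) is constructed explicitly, then sealed by Qed: everything else only  *)
(* uses the properties listed in the record, which determine it up to a unique *)
(* isomorphism, and unification never unfolds the construction.                *)
Record lquot_spec (k : fieldType) (V : lmodType k) (I : submodClosed V) := LquotSpec {
  lquot_car : lmodType k;
  lquot_pi : {linear V -> lquot_car};
  lquot_piP : forall x, lquot_pi x = 0 <-> x \in I;
  lquot_pi_onto : forall q, exists x, lquot_pi x = q;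
}.

Section LmodQuotient.
Variables (k : fieldType) (V : lmodType k) (I : submodClosed V).

Definition subm : {pred V} := fun x => x \in I.

Fact subm_zmod_closed : zmod_closed subm.
Proof.
by split=> [|x y xI yI]; rewrite unfold_in ?rpred0 // -scaleN1r rpredD // rpredZ.
Qed.
HB.instance Definition _ := GRing.isZmodClosed.Build V subm subm_zmod_closed.

Definition cquot : Type := Quotient.quot subm.
HB.instance Definition _ := GRing.Zmodule.on cquot.

Definition cpi : V -> cquot := \pi_(Quotient.quot subm).

Lemma cpi_eq x y : (cpi x = cpi y) <-> x - y \in I.
Proof.
rewrite /cpi; split=> [h|h]; last by apply/eqP; rewrite -Quotient.idealrBE.
by have := Quotient.idealrBE subm x y; rewrite h eqxx.
Qed.

Lemma cpi_surj (q : cquot) : exists x, cpi x = q.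
Proof. by exists (repr (q : Quotient.quot subm)); rewrite /cpi reprK. Qed.

Definition cquot_scale (a : k) (q : cquot) : cquot :=
  cpi (a *: repr (q : Quotient.quot subm)).

Lemma cquot_scaleE a x : cquot_scale a (cpi x) = cpi (a *: x).
Proof.
apply/cpi_eq; rewrite -scalerBr rpredZ //; apply/cpi_eq.
by rewrite /cpi reprK.
Qed.

Lemma cpiB x y : cpi (x - y) = cpi x - cpi y.
Proof. rewrite /cpi; exact: (raddfB (\pi_(Quotient.quot subm))). Qed.
Lemma cpiD x y : cpi (x + y) = cpi x + cpi y.
Proof. rewrite /cpi; exact: (raddfD (\pi_(Quotient.quot subm))). Qed.

Fact cquot_scaleA a b q :
  cquot_scale a (cquot_scale b q) = cquot_scale (a * b) q.
Proof. by have [x <-] := cpi_surj q; rewrite !cquot_scaleE scalerA. Qed.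
Fact cquot_scale1 : left_id 1 cquot_scale.
Proof. by move=> q; have [x <-] := cpi_surj q; rewrite cquot_scaleE scale1r. Qed.
Fact cquot_scaleDr : right_distributive cquot_scale +%R.
Proof.
move=> a p q; have [x <-] := cpi_surj p; have [y <-] := cpi_surj q.
by rewrite -cpiD !cquot_scaleE scalerDr cpiD.
Qed.
Fact cquot_scaleDl q : {morph cquot_scale^~ q : a b / a + b}.
Proof.
by move=> a b; have [x <-] := cpi_surj q; rewrite !cquot_scaleE scalerDl cpiD.
Qed.
HB.instance Definition _ := GRing.Zmodule_isLmodule.Build k cquot
  cquot_scaleA cquot_scale1 cquot_scaleDr cquot_scaleDl.

Fact cpi_linear : linear cpi.
Proof. by move=> a x y; rewrite cpiD -cquot_scaleE. Qed.
HB.instance Definition _ := GRing.isLinear.Build k V cquot _ cpi cpi_linear.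


Fact cpi_eq0 x : cpi x = 0 <-> x \in I.
Proof. by rewrite -(linear0 cpi) cpi_eq subr0. Qed.

Fact lquot_construction : lquot_spec I.
Proof. exact: (@LquotSpec k V I cquot cpi cpi_eq0 cpi_surj). Qed.
End LmodQuotient.

Section Lquot.
Variables (k : fieldType) (V : lmodType k) (I : submodClosed V).

Definition lquot : lmodType k := lquot_car (lquot_construction I).
Definition lpi : {linear V -> lquot} := lquot_pi (lquot_construction I).

Lemma lpi_eq0 x : lpi x = 0 <-> x \in I.
Proof. exact: lquot_piP. Qed.
Lemma lpi_onto q : exists x, lpi x = q.
Proof. exact: lquot_pi_onto. Qed.
Lemma lpi_eq x y : lpi x = lpi y <-> x - y \in I.
Proof.
by rewrite -lpi_eq0 linearB; split=> [->|/eqP]; rewrite ?subrr // subr_eq0 => /eqP.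
Qed.
End Lquot.

Section LquotLift.
Variables (k : fieldType) (V U : lmodType k) (I : submodClosed V).
Variables (f : {linear V -> U}) (f0 : forall x, x \in I -> f x = 0).

Definition lquot_lift of (forall x, x \in I -> f x = 0) :=
  fun q : lquot I => f (xget 0 [set x | lpi I x = q]%classic).

Lemma lquot_liftE x : lquot_lift f0 (lpi I x) = f x.
Proof.
rewrite /lquot_lift; case: xgetP => [y _ /= yx|/(_ x)/(_ erefl)//].
by apply/eqP; rewrite -subr_eq0 -linearB; apply/eqP/f0/lpi_eq.
Qed.

Fact lquot_lift_linear : linear (lquot_lift f0).
Proof.
move=> a p q; have [x <-] := lpi_onto p; have [y <-] := lpi_onto q.
by rewrite -linearP !lquot_liftE linearP.
Qed.
HB.instance Definition _ :=
  GRing.isLinear.Build k (lquot I) U _ (lquot_lift f0) lquot_lift_linear.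

End LquotLift.
Arguments lquot_lift {k V U I f} _ _ : simpl never.

Lemma lquot_ext (k : fieldType) (V : lmodType k) (I : submodClosed V) (U : Type)
  (f g : lquot I -> U) : (forall x, f (lpi I x) = g (lpi I x)) -> f =1 g.
Proof. by move=> fg q; have [x <-] := lpi_onto q. Qed.

Section Span.
Variables (k : fieldType) (V : lmodType k) (S : set V).

Definition span : {pred V} := fun x =>
  `[< exists2 s : seq (k * V), (forall p, p \in s -> S p.2) &
      x = \sum_(p <- s) p.1 *: p.2 >].

Fact span_closed : subsemimod_closed span.
Proof.
split; [split|].
- by apply/asboolP; exists [::] => //; rewrite big_nil.
- move=> x y /asboolP[s Ss ->] /asboolP[t St ->]; apply/asboolP.
  exists (s ++ t); last by rewrite big_cat.
  by move=> p; rewrite mem_cat => /orP[/Ss|/St].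
- move=> a x /asboolP[s Ss ->]; apply/asboolP.
  exists [seq (a * p.1, p.2) | p <- s]; first by move=> p /mapP[q /Ss ? ->].
  by rewrite big_map scaler_sumr; apply: eq_bigr => i _; rewrite scalerA.
Qed.
HB.instance Definition _ := GRing.isSubmodClosed.Build k V span span_closed.

Lemma mem_span x : S x -> x \in span.
Proof.
move=> Sx; apply/asboolP; exists [:: (1, x)]; last by rewrite big_seq1 scale1r.
by move=> p; rewrite inE => /eqP ->.
Qed.

Lemma span_ind (P : V -> Prop) :
  P 0 -> (forall a x y, P x -> P y -> P (a *: x + y)) -> (forall x, S x -> P x) ->
  forall x, x \in span -> P x.
Proof.
move=> P0 PD PS x /asboolP[s + ->]; elim: s => [|p s IH] Ss; first by rewrite big_nil.
rewrite big_cons; apply: PD; first by apply/PS/Ss; rewrite mem_head.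
by apply: IH => q qs; apply: Ss; rewrite inE qs orbT.
Qed.
End Span.

Lemma span_lker (k : fieldType) (V U : lmodType k) (S : set V)
    (f : {linear V -> U}) : (forall x, S x -> f x = 0) ->
  forall x, x \in span S -> f x = 0.
Proof.
move=> fS; apply: (@span_ind _ _ _ (fun x => f x = 0)) => // [|a x y fx fy].
  exact: linear0.
by rewrite linearP fx fy scaler0 addr0.
Qed.

Local Notation fgU x := [freeg [:: (1, x)]].

Section FreeLift.
Variables (k : fieldType) (K : choiceType) (U : lmodType k) (f : K -> U).

Lemma freeg_lin_ind (P : {freeg K / k} -> Prop) :
  P 0 -> (forall a x D, P D -> P (a *: fgU x + D)) -> forall D, P D.
Proof.
move=> P0 PD D; rewrite -[D]freeg_sumE.
elim: (dom D) => [|x s IH]; first by rewrite big_nil.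
rewrite big_cons.
have -> : [freeg [:: (coeff x D, x)]] = coeff x D *: fgU x :> {freeg K / k}.
  by apply/eqP/freeg_eqP => y; rewrite coeffZ !coeffU mul1r.
exact: PD.
Qed.

Lemma fgliftU1 x : fglift f (fgU x) = f x.
Proof. by rewrite liftU scale1r. Qed.

Fact fglift_linear : linear (fglift f).
Proof.
have addf : {morph fglift f : x y / x + y}.
  have subf := lift_is_additive f.
  have f0 : fglift f 0 = 0 by rewrite -[X in fglift f X](subrr 0) subf subrr.
  have fN x : fglift f (- x) = - fglift f x by rewrite -(sub0r x) subf f0 sub0r.
  by move=> x y; rewrite -{1}[y]opprK subf fN opprK.
move=> a x y; rewrite addf; congr (_ + _).
have f0 : fglift f 0 = 0 by apply: (addIr (fglift f 0)); rewrite -addf !add0r.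
elim/freeg_lin_ind: x => [|b x D IH]; first by rewrite scaler0 f0 scaler0.
rewrite scalerDr !addf IH scalerDr; congr (_ + _).
have hU c : fglift f (c *: fgU x) = c *: f x.
  rewrite -(liftU f c x); congr (fglift f _).
  by apply/eqP/freeg_eqP => y'; rewrite coeffZ !coeffU mul1r.
by rewrite scalerA !hU scalerA.
Qed.
End FreeLift.
HB.instance Definition _ (k : fieldType) (K : choiceType) (U : lmodType k)
  (f : K -> U) :=
  GRing.isLinear.Build k {freeg K / k} U _ (fglift f) (@fglift_linear k K U f).

Definition bilin (k : fieldType) (V W U : lmodType k) (f : V -> W -> U) : Prop :=
  (forall w a v v', f (a *: v + v') w = a *: f v w + f v' w) /\
  (forall v a w w', f v (a *: w + w') = a *: f v w + f v w').

(* tensor_ind says that pure tensors generate, i.e. that tensor_lift is unique. *)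
Record tensor_spec (k : fieldType) (V W : lmodType k) := TensorSpec {
  tensor_car : lmodType k;
  tensor_pure : V -> W -> tensor_car;
  tensor_bilin : bilin tensor_pure;
  tensor_lift : forall (U : lmodType k) (f : V -> W -> U),
    bilin f -> {linear tensor_car -> U};
  tensor_liftE : forall U f (fbil : @bilin k V W U f) v w,
    tensor_lift fbil (tensor_pure v w) = f v w;
  tensor_ind : forall P : tensor_car -> Prop,
    P 0 -> (forall v w t, P t -> P (tensor_pure v w + t)) -> forall t, P t;
}.

Section Tensor.
Variables (k : fieldType) (V W : lmodType k).

(* V (x) W is the free vector space on V * W modulo bilinearity. *)
Definition tens_rel : set {freeg (V * W)%type / k} := [set d |
  (exists a v v' w, d = fgU (a *: v + v', w) - (a *: fgU (v, w) + fgU (v', w)))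
  \/ (exists a v w w', d = fgU (v, a *: w + w') - (a *: fgU (v, w) + fgU (v, w')))]%classic.

Definition ctens : lmodType k := lquot (span tens_rel).

Definition cpure (v : V) (w : W) : ctens := lpi (span tens_rel) (fgU (v, w)).

Fact cpure_bilin : bilin cpure.
Proof.
split=> [w a v v'|v a w w']; rewrite /cpure -linearP; apply/lpi_eq/mem_span.
  by left; exists a, v, v', w.
by right; exists a, v, w, w'.
Qed.

Lemma ctens_ind (P : ctens -> Prop) :
  P 0 -> (forall v w t, P t -> P (cpure v w + t)) -> forall t, P t.
Proof.
move=> P0 PD t; have [D <-] := lpi_onto t.
elim/freeg_lin_ind: D => [|a [v w] D IH]; first by rewrite linear0.
have h0 : cpure 0 w = 0.
  have := proj1 cpure_bilin w (-1) 0 0; rewrite /= scaler0 addr0 => ->.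
  by rewrite scaleN1r addNr.
have hZ : a *: cpure v w = cpure (a *: v) w.
  by have := proj1 cpure_bilin w a v 0; rewrite /= h0 !addr0.
have -> : lpi (span tens_rel) (a *: fgU (v, w) + D) =
          a *: cpure v w + (lpi (span tens_rel) D : ctens) by exact: linearP.
rewrite hZ; exact: PD.
Qed.

Section Lift.
Variables (U : lmodType k) (f : V -> W -> U) (fbil : bilin f).

Fact clift_subproof x :
  x \in span tens_rel -> fglift (fun p : V * W => f p.1 p.2) x = 0.
Proof.
apply: (@span_lker k _ _ tens_rel (fglift _)) => _ [[a][v][v'][w]->|[a][v][w][w']->].
  by rewrite linearB linearP /= !fgliftU1 /=; have /= -> := proj1 fbil w a v v'; rewrite subrr.
by rewrite linearB linearP /= !fgliftU1 /=; have /= -> := proj2 fbil v a w w'; rewrite subrr.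
Qed.

Definition clift : ctens -> U := lquot_lift clift_subproof.
Fact clift_linear : linear clift.
Proof. exact: linearP. Qed.
HB.instance Definition _ := GRing.isLinear.Build k ctens U _ clift clift_linear.

Lemma cliftE v w : clift (cpure v w) = f v w.
Proof. by rewrite /clift [LHS]lquot_liftE /= fgliftU1. Qed.
End Lift.


Fact tensor_construction : tensor_spec V W.
Proof.
exact: (@TensorSpec k V W ctens cpure cpure_bilin (fun U f h => @clift U f h)
  cliftE ctens_ind).
Qed.
End Tensor.

Section Tens.
Variables (k : fieldType) (V W : lmodType k).

Definition tens : Type := tensor_car (tensor_construction V W).
HB.instance Definition _ := GRing.Lmodule.on tens.

Definition tpure (v : V) (w : W) : tens := tensor_pure (tensor_construction V W) v w.
Lemma tpure_bilin : bilin tpure.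
Proof. exact: tensor_bilin. Qed.

Lemma tens_ind (P : tens -> Prop) :
  P 0 -> (forall v w t, P t -> P (tpure v w + t)) -> forall t, P t.
Proof. exact: tensor_ind. Qed.

Section Tlift.
Variables (U : lmodType k) (f : V -> W -> U) (fbil : bilin f).
Definition tlift : tens -> U := tensor_lift (tensor_construction V W) fbil.
Fact tlift_linear : linear tlift.
Proof. exact: linearP. Qed.
HB.instance Definition _ := GRing.isLinear.Build k tens U _ tlift tlift_linear.
Lemma tliftE v w : tlift (tpure v w) = f v w.
Proof. exact: tensor_liftE. Qed.
End Tlift.
Arguments tlift : simpl never.

Lemma tens_ext (U : lmodType k) (f g : {linear tens -> U}) :
  (forall v w, f (tpure v w) = g (tpure v w)) -> f =1 g.
Proof.
move=> fg t; elim/tens_ind: t => [|v w t IH]; first by rewrite !linear0.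
by rewrite !linearD fg IH.
Qed.
End Tens.
Arguments tlift {k V W U f} _ _ : simpl never.

Section TensorTheory.
Variables (k : fieldType) (V W : lmodType k).
Implicit Types (v : V) (w : W) (a : k).
Local Notation tp := (@tpure k V W).

Lemma tpurePl a v v' w : tp (a *: v + v') w = a *: tp v w + tp v' w.
Proof. exact: (proj1 (tpure_bilin V W)). Qed.
Lemma tpurePr a v w w' : tp v (a *: w + w') = a *: tp v w + tp v w'.
Proof. exact: (proj2 (tpure_bilin V W)). Qed.
Lemma tpureDl v v' w : tp (v + v') w = tp v w + tp v' w.
Proof. by have := tpurePl 1 v v' w; rewrite !scale1r. Qed.
Lemma tpureDr v w w' : tp v (w + w') = tp v w + tp v w'.
Proof. by have := tpurePr 1 v w w'; rewrite !scale1r. Qed.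
Lemma tpure0l w : tp 0 w = 0.
Proof. by apply: (addIr (tp 0 w)); rewrite -tpureDl !add0r. Qed.
Lemma tpure0r v : tp v 0 = 0.
Proof. by apply: (addIr (tp v 0)); rewrite -tpureDr !add0r. Qed.
Lemma tpureZl a v w : tp (a *: v) w = a *: tp v w.
Proof. by have := tpurePl a v 0 w; rewrite tpure0l !addr0. Qed.
Lemma tpureZr a v w : tp v (a *: w) = a *: tp v w.
Proof. by have := tpurePr a v w 0; rewrite tpure0r !addr0. Qed.
Lemma tpure_suml (J : Type) (s : seq J) (F : J -> V) w :
  tp (\sum_(i <- s) F i) w = \sum_(i <- s) tp (F i) w.
Proof. by elim: s => [|i s IH]; rewrite ?big_nil ?tpure0l // !big_cons tpureDl IH. Qed.
Lemma tpure_sumr (J : Type) (s : seq J) (F : J -> W) v :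
  tp v (\sum_(i <- s) F i) = \sum_(i <- s) tp v (F i).
Proof. by elim: s => [|i s IH]; rewrite ?big_nil ?tpure0r // !big_cons tpureDr IH. Qed.

Lemma tens_sum (t : tens V W) :
  exists s : seq (V * W), t = \sum_(p <- s) tpure p.1 p.2.
Proof.
elim/tens_ind: t => [|v w t [s ->]]; first by exists [::]; rewrite big_nil.
by exists ((v, w) :: s); rewrite big_cons.
Qed.

Lemma bilin_tlift (X U : lmodType k) (F : X -> V -> W -> U)
    (hF : forall x, bilin (F x)) : (forall v w, linear (fun x => F x v w)) ->
  bilin (fun (x : X) (t : tens V W) => tlift (hF x) t).
Proof.
move=> hX; split=> [t a x y|x a s t]; last exact: linearP.
have h z : tlift (hF z) 0 = 0 by exact: linear0.
have hD z v w t' : tlift (hF z) (tpure v w + t') = F z v w + tlift (hF z) t'.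
  by rewrite linearD /= tliftE.
elim/tens_ind: t => [|v w t IH] /=; first by rewrite !h scaler0 addr0.
by rewrite !hD IH hX scalerDr addrACA.
Qed.
End TensorTheory.

Section Lift22.
Variables (k : fieldType) (V W V' W' U : lmodType k).
Variable F : V -> W -> V' -> W' -> U.
Hypothesis F12 : forall v' w', bilin (fun v w => F v w v' w').
Hypothesis F34 : forall v w, bilin (F v w).

Fact tlift22_subproof t : bilin (fun v w => tlift (F34 v w) t).
Proof.
split=> [w a v v'|v a w w'].
  have := (@bilin_tlift _ _ _ V U (fun v => F v w) (F34^~ w) _).1 t a v v'; apply.
  by move=> v1 w1; exact: (proj1 (F12 v1 w1)).
have := (@bilin_tlift _ _ _ W U (fun w => F v w) (F34 v) _).1 t a w w'; apply.
by move=> v1 w1; exact: (proj2 (F12 v1 w1)).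
Qed.

Definition tlift22 (s : tens V W) (t : tens V' W') : U :=
  tlift (tlift22_subproof t) s.

Lemma tlift22E v w v' w' : tlift22 (tpure v w) (tpure v' w') = F v w v' w'.
Proof. by rewrite /tlift22 !tliftE. Qed.

Lemma tlift22_bilin : bilin tlift22.
Proof.
split=> [t a s s'|s a t t']; first exact: linearP.
have h u : tlift22 0 u = 0 by exact: linear0.
have hD v w s1 u : tlift22 (tpure v w + s1) u = tlift (F34 v w) u + tlift22 s1 u.
  by rewrite {1}/tlift22 linearD /= tliftE.
elim/tens_ind: s => [|v w s IH] /=; first by rewrite !h scaler0 addr0.
by rewrite !hD IH linearP scalerDr addrACA.
Qed.
End Lift22.

Section TensorMaps.
Variable k : fieldType.
Implicit Types V W X U : lmodType k.

Section Tmap.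
Variables (V V' W W' : lmodType k) (f : {linear V -> V'}) (g : {linear W -> W'}).

Fact tmap_subproof : bilin (fun v w => tpure (f v) (g w)).
Proof. by split=> [w a v v'|v a w w'] /=; rewrite linearP ?tpurePl ?tpurePr. Qed.
Definition tmap : tens V W -> tens V' W' := tlift tmap_subproof.
HB.instance Definition _ := GRing.Linear.on tmap.

Lemma tmapE v w : tmap (tpure v w) = tpure (f v) (g w).
Proof. exact: tliftE. Qed.
End Tmap.
Arguments tmap : simpl never.

Fact tassoc_subproof1 V W X (x : X) :
  bilin (fun (v : V) (w : W) => tpure v (tpure w x)).
Proof. by split=> [w a v v'|v a w w'] /=; rewrite !(tpurePl, tpurePr). Qed.
Fact tassoc_subproof2 V W X :
  bilin (fun (t : tens V W) (x : X) => tlift (tassoc_subproof1 V W x) t).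
Proof.
have h : bilin (fun (x : X) (t : tens V W) => tlift (tassoc_subproof1 V W x) t).
  by apply: bilin_tlift => v w b y1 y2; rewrite !tpurePr.
by split=> [x|t]; [exact: (proj2 h) | exact: (proj1 h)].
Qed.
(* (v (x) w) (x) x |-> v (x) (w (x) x) *)
Definition tassoc V W X : tens (tens V W) X -> tens V (tens W X) :=
  tlift (tassoc_subproof2 V W X).
HB.instance Definition _ V W X := GRing.Linear.on (@tassoc V W X).
Lemma tassocE V W X (v : V) (w : W) (x : X) :
  tassoc (tpure (tpure v w) x) = tpure v (tpure w x).
Proof. by rewrite /tassoc !tliftE. Qed.

Fact tlunit_subproof V : bilin (fun (a : k^o) (v : V) => (a : k) *: v).
Proof.
split=> [v a b c|b a v w] /=; first by rewrite scalerDl -scalerA.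
by rewrite scalerDr !scalerA mulrC.
Qed.
Definition tlunit V : tens k^o V -> V := tlift (tlunit_subproof V).
HB.instance Definition _ V := GRing.Linear.on (@tlunit V).
Lemma tlunitE V (a : k) (v : V) : tlunit (tpure (a : k^o) v) = a *: v.
Proof. exact: tliftE. Qed.

Fact trunit_subproof V : bilin (fun (v : V) (a : k^o) => (a : k) *: v).
Proof. by split=> [b a v w|v a b c]; apply tlunit_subproof. Qed.
Definition trunit V : tens V k^o -> V := tlift (trunit_subproof V).
HB.instance Definition _ V := GRing.Linear.on (@trunit V).
Lemma trunitE V (v : V) (a : k) : trunit (tpure v (a : k^o)) = a *: v.
Proof. exact: tliftE. Qed.
End TensorMaps.
Arguments tmap : simpl never.
Arguments tassoc : simpl never.
Arguments tlunit : simpl never.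
Arguments trunit : simpl never.

Section TensorRing.
Variables (k : fieldType) (A A' : algType k).

Fact tmul_subproof1 (c : A) (d : A') : bilin (fun a b => tpure (a * c) (b * d)).
Proof.
split=> [b x a a'|a x b b'] /=.
  by rewrite mulrDl -scalerAl tpurePl.
by rewrite mulrDl -scalerAl tpurePr.
Qed.
Fact tmul_subproof2 (a : A) (b : A') : bilin (fun c d => tpure (a * c) (b * d)).
Proof.
split=> [d x c c'|c x d d'] /=.
  by rewrite mulrDr -scalerAr tpurePl.
by rewrite mulrDr -scalerAr tpurePr.
Qed.

(* (a (x) b)(c (x) d) = ac (x) bd *)
Definition tmul : tens A A' -> tens A A' -> tens A A' :=
  tlift22 tmul_subproof1 tmul_subproof2.
Definition tone : tens A A' := tpure 1 1.

Lemma tmulE a b c d : tmul (tpure a b) (tpure c d) = tpure (a * c) (b * d).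
Proof. exact: tlift22E. Qed.

Let tmulPl x s s' t : tmul (x *: s + s') t = x *: tmul s t + tmul s' t.
Proof. exact: (proj1 (tlift22_bilin tmul_subproof1 tmul_subproof2)). Qed.
Let tmulPr x s t t' : tmul s (x *: t + t') = x *: tmul s t + tmul s t'.
Proof. exact: (proj2 (tlift22_bilin tmul_subproof1 tmul_subproof2)). Qed.

Fact tmulDl : left_distributive tmul +%R.
Proof. by move=> s s' t; have := tmulPl 1 s s' t; rewrite !scale1r. Qed.
Fact tmulDr : right_distributive tmul +%R.
Proof. by move=> s t t'; have := tmulPr 1 s t t'; rewrite !scale1r. Qed.
Let tmul0l t : tmul 0 t = 0.
Proof. by apply: (addIr (tmul 0 t)); rewrite -tmulDl !add0r. Qed.
Let tmul0r t : tmul t 0 = 0.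
Proof. by apply: (addIr (tmul t 0)); rewrite -tmulDr !add0r. Qed.
Fact tmulA : associative tmul.
Proof.
move=> s t u; elim/tens_ind: s => [|a b s IHs]; first by rewrite !tmul0l.
rewrite !tmulDl IHs; congr (_ + _); elim/tens_ind: t {IHs} => [|c d t IHt].
  by rewrite !(tmul0l, tmul0r).
rewrite !(tmulDl, tmulDr) IHt; congr (_ + _).
elim/tens_ind: u {IHt} => [|e f u IHu]; first by rewrite !tmul0r.
by rewrite !tmulDr IHu !tmulE !mulrA.
Qed.
Fact tmul1l : left_id tone tmul.
Proof.
move=> t; elim/tens_ind: t => [|a b t IH]; first by rewrite tmul0r.
by rewrite tmulDr IH tmulE !mul1r.
Qed.
Fact tmul1r : right_id tone tmul.
Proof.
move=> t; elim/tens_ind: t => [|a b t IH]; first by rewrite tmul0l.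
by rewrite tmulDl IH tmulE !mulr1.
Qed.
HB.instance Definition _ := GRing.Zmodule_isPzRing.Build (tens A A')
  tmulA tmul1l tmul1r tmulDl tmulDr.

Lemma tensM a b c d :
  tpure a b * tpure c d = tpure (a * c) (b * d) :> tens A A'.
Proof. exact: tmulE. Qed.
Lemma tens1 : 1 = tpure 1 1 :> tens A A'. Proof. by []. Qed.
Lemma tens_scaleAl x (s t : tens A A') : (x *: s) * t = x *: (s * t).
Proof. by have := tmulPl x s 0 t; rewrite tmul0l !addr0. Qed.
Lemma tens_scaleAr x (s t : tens A A') : s * (x *: t) = x *: (s * t).
Proof. by have := tmulPr x s t 0; rewrite tmul0r !addr0. Qed.
End TensorRing.

(* k^o is k as a vector space over itself; tlunit and trunit are the canonical *)
(* isomorphisms k (x) C -> C and C (x) k -> C.                                  *)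
HB.mixin Record isCoalgebra (k : fieldType) C of GRing.Lmodule k C := {
  comul : {linear C -> tens C C};
  counit : {linear C -> k^o};
  comulA : forall x,
    tassoc (tmap comul idfun (comul x)) = tmap idfun comul (comul x);
  counitl : forall x, tlunit (tmap counit idfun (comul x)) = x;
  counitr : forall x, trunit (tmap idfun counit (comul x)) = x;
}.
#[short(type="coalgType")]
HB.structure Definition Coalgebra (k : fieldType) :=
  {C of GRing.Lmodule k C & isCoalgebra k C}.

(* The products of tensors are taken in the tensor product algebra B (x) B.     *)
HB.mixin Record isBialgebra (k : fieldType) B of GRing.Algebra k B & Coalgebra k B := {
  comulM : forall x y : B, (comul (x * y) : tens B B) = comul x * comul y;
  comul1 : comul (1 : B) = 1 :> tens B B;
  counitM : forall x y : B, counit (x * y) = counit x * counit y;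
  counit1 : counit (1 : B) = 1;
}.
#[short(type="bialgType")]
HB.structure Definition Bialgebra (k : fieldType) :=
  {B of GRing.Algebra k B & Coalgebra k B & isBialgebra k B}.

Section Sweedler.
Variables (k : fieldType) (C : coalgType k).
Implicit Types (x : C).

(* a chosen decomposition of comul x as a finite sum of pure tensors *)
Definition swd x : seq (C * C) := projT1 (cid (tens_sum (comul x))).

Lemma swdE x : comul x = \sum_(p <- swd x) tpure p.1 p.2.
Proof. exact: projT2 (cid (tens_sum (comul x))). Qed.

Lemma sw_lift (U : lmodType k) (f : C -> C -> U) (hf : bilin f) x :
  tlift hf (comul x) = \sum_(p <- swd x) f p.1 p.2.
Proof. by rewrite swdE linear_sum; apply: eq_bigr => p _; rewrite /= tliftE. Qed.

Lemma sw_counitl x : \sum_(p <- swd x) (counit p.1 : k) *: p.2 = x.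
Proof.
rewrite -[RHS]counitl swdE !linear_sum; apply: eq_bigr => p _ /=.
by rewrite tmapE tlunitE.
Qed.

Lemma sw_counitr x : \sum_(p <- swd x) (counit p.2 : k) *: p.1 = x.
Proof.
rewrite -[RHS]counitr swdE !linear_sum; apply: eq_bigr => p _ /=.
by rewrite tmapE trunitE.
Qed.

Section Trilinear.
Variables (U : lmodType k) (F : C -> C -> C -> U).
Hypothesis F1 : forall y z, linear (fun x => F x y z).
Hypothesis F2 : forall x z, linear (fun y => F x y z).
Hypothesis F3 : forall x y, linear (fun z => F x y z).

Let F23 x : bilin (F x).
Proof. by split=> [z|y]; [exact: F2 | exact: F3]. Qed.
Let L_bil : bilin (fun x t => tlift (F23 x) t).
Proof. by apply: bilin_tlift => y z; exact: F1. Qed.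

Lemma sw_assoc x :
  \sum_(p <- swd x) \sum_(q <- swd p.1) F q.1 q.2 p.2 =
  \sum_(p <- swd x) \sum_(q <- swd p.2) F p.1 q.1 q.2.
Proof.
have := congr1 (tlift L_bil) (comulA x).
rewrite [comul x]swdE !linear_sum /=.
under eq_bigr => p _.
  rewrite tmapE /= swdE tpure_suml !linear_sum /=.
  under eq_bigr do rewrite tassocE !tliftE.
  over.
move=> ->; apply: eq_bigr => p _.
by rewrite tmapE /= swdE tpure_sumr linear_sum /=; apply: eq_bigr => q _; rewrite !tliftE.
Qed.
End Trilinear.

Lemma sw_linear (U : lmodType k) (f : C -> C -> U) (hf : bilin f) :
  linear (fun x => \sum_(p <- swd x) f p.1 p.2).
Proof. by move=> a x y; rewrite -!(sw_lift hf) linearP linearP. Qed.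

Lemma sw_linear_fst (U U' : lmodType k) (f : U' -> C -> C -> U) x :
  (forall y z, linear (fun u => f u y z)) ->
  linear (fun u => \sum_(p <- swd x) f u p.1 p.2).
Proof.
move=> hf a u v; rewrite scaler_sumr -big_split; apply: eq_bigr => p _.
exact: hf.
Qed.
End Sweedler.

Section Oslash.
Variables (k : fieldType) (B : bialgType k).

(* the products t * Delta(b) with b in B^+ = ker(epsilon) *)
Definition oslash_gen : set (tens B B) :=
  [set u | exists t b, counit b = 0 /\ u = t * comul b]%classic.

Definition oslash : Type := lquot (span oslash_gen).
HB.instance Definition _ := GRing.Lmodule.on oslash.

Definition opi : tens B B -> oslash := lpi (span oslash_gen).
Fact opi_linear : linear opi.
Proof. exact: linearP. Qed.
HB.instance Definition _ := GRing.isLinear.Build k (tens B B) oslash _ opi opi_linear.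
Arguments opi : simpl never.

(* ocls x y is x oslash y, the class of x (x) y *)
Definition ocls (x y : B) : oslash := opi (tpure x y).

Fact ocls_bilin : bilin ocls.
Proof. by split=> [y a x x'|x a y y']; rewrite /ocls ?tpurePl ?tpurePr linearP. Qed.

Lemma oclsPl a x x' y : ocls (a *: x + x') y = a *: ocls x y + ocls x' y.
Proof. exact: (proj1 ocls_bilin). Qed.
Lemma oclsPr a x y y' : ocls x (a *: y + y') = a *: ocls x y + ocls x y'.
Proof. exact: (proj2 ocls_bilin). Qed.
Lemma oclsZl a x y : ocls (a *: x) y = a *: ocls x y.
Proof. by rewrite /ocls tpureZl linearZ. Qed.
Lemma oclsZr a x y : ocls x (a *: y) = a *: ocls x y.
Proof. by rewrite /ocls tpureZr linearZ. Qed.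
Lemma ocls_suml (J : Type) (s : seq J) (F : J -> B) y :
  ocls (\sum_(i <- s) F i) y = \sum_(i <- s) ocls (F i) y.
Proof. by rewrite /ocls tpure_suml linear_sum. Qed.
Lemma ocls_sumr (J : Type) (s : seq J) (F : J -> B) x :
  ocls x (\sum_(i <- s) F i) = \sum_(i <- s) ocls x (F i).
Proof. by rewrite /ocls tpure_sumr linear_sum. Qed.

Lemma opi_onto (q : oslash) : exists t, opi t = q.
Proof. exact: lpi_onto. Qed.

Lemma ocls_ind (P : oslash -> Prop) :
  P 0 -> (forall x y t, P t -> P (ocls x y + t)) -> forall t, P t.
Proof.
move=> P0 PD q; have [t <-] := opi_onto q.
elim/tens_ind: t => [|x y t IH]; first by rewrite linear0.
by rewrite linearD /=; exact: PD.
Qed.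

Lemma ocls_ext (U : lmodType k) (f g : {linear oslash -> U}) :
  (forall x y, f (ocls x y) = g (ocls x y)) -> f =1 g.
Proof.
move=> fg t; elim/ocls_ind: t => [|v w t IH]; first by rewrite !linear0.
by rewrite !linearD fg IH.
Qed.

Lemma opi_mul_comul t b : opi (t * comul b) = (counit b : k) *: opi t.
Proof.
have : opi (t * comul (b - (counit b : k) *: 1)) = 0.
  apply/lpi_eq0/mem_span; exists t, (b - (counit b : k) *: 1); split=> //.
  by rewrite linearB linearZ /= counit1 [X in _ - X]mulr1 subrr.
rewrite linearB linearZ /= comul1 mulrBr tens_scaleAr mulr1.
by rewrite linearB linearZ /= => /eqP; rewrite subr_eq0 => /eqP.
Qed.

Lemma ocls_sw x y c : \sum_(p <- swd c) ocls (x * p.1) (y * p.2) = (counit c : k) *: ocls x y.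
Proof.
rewrite /ocls -opi_mul_comul swdE mulr_sumr linear_sum.
by apply: eq_bigr => p _; rewrite /= tensM.
Qed.

Fact ocounit0_subproof : bilin (fun x y : B => (counit x : k) *: (counit y : k^o)).
Proof.
split=> [y a x x'|x a y y'] /=; first by rewrite linearP /= scalerDl -scalerA.
by rewrite linearP /= scalerDr !scalerA mulrC.
Qed.
Definition ocounit0 : tens B B -> k^o := tlift ocounit0_subproof.
HB.instance Definition _ := GRing.Linear.on ocounit0.

Lemma ocounit0_comul b : ocounit0 (comul b) = counit b.
Proof.
rewrite /ocounit0 sw_lift -[X in counit X]sw_counitl linear_sum.
by apply: eq_bigr => p _; rewrite linearZ.
Qed.

Lemma ocounit0M s t : ocounit0 (s * t) = ocounit0 s * ocounit0 t.
Proof.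
elim/tens_ind: s => [|x y s IH]; first by rewrite mul0r linear0 mul0r.
rewrite mulrDl !linearD /= mulrDl {}IH; congr (_ + _).
elim/tens_ind: t => [|z w t IH]; first by rewrite mulr0 linear0 mulr0.
rewrite mulrDr !linearD /= mulrDr {}IH; congr (_ + _).
by rewrite tensM /ocounit0 !tliftE !counitM [RHS]mulrACA.
Qed.

Fact ocounit_subproof u : u \in span oslash_gen -> ocounit0 u = 0.
Proof.
move=> h; apply: (@span_lker _ _ _ oslash_gen (@ocounit0)) h => _ [t [b [b0 ->]]].
by rewrite /= ocounit0M ocounit0_comul b0 mulr0.
Qed.
Definition ocounit : oslash -> k^o := lquot_lift ocounit_subproof.
Fact ocounit_linear : linear ocounit. Proof. exact: linearP. Qed.
HB.instance Definition _ := GRing.isLinear.Build k oslash k^o _ ocounit ocounit_linear.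
Lemma ocounitE x y : ocounit (ocls x y) = counit x * counit y.
Proof. by rewrite -[RHS](tliftE ocounit0_subproof); exact: lquot_liftE. Qed.

Fact oshuf_subproof1 (c d : B) : bilin (fun a b => tpure (ocls a d) (ocls b c)).
Proof. by split=> [b x a a'|a x b b'] /=; rewrite ?oclsPl ?(tpurePl, tpurePr). Qed.
Fact oshuf_subproof2 (a b : B) : bilin (fun c d => tpure (ocls a d) (ocls b c)).
Proof. by split=> [d x c c'|c x d d'] /=; rewrite ?oclsPr ?(tpurePl, tpurePr). Qed.
(* (a (x) b) (x) (c (x) d) |-> ocls a d (x) ocls b c, so that ocomul below sends
   ocls x y to the sum of ocls x_1 y_2 (x) ocls x_2 y_1 (see ocomulE) *)
Definition oshuf : tens (tens B B) (tens B B) -> tens oslash oslash :=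
  tlift (tlift22_bilin oshuf_subproof1 oshuf_subproof2).
HB.instance Definition _ := GRing.Linear.on oshuf.

Lemma oshufE a b c d :
  oshuf (tpure (tpure a b) (tpure c d)) = tpure (ocls a d) (ocls b c).
Proof. by rewrite /oshuf tliftE tlift22E. Qed.

Definition ocomul0 : tens B B -> tens oslash oslash := oshuf \o tmap comul comul.
HB.instance Definition _ := GRing.Linear.on ocomul0.

Lemma ocomul0E x y : ocomul0 (tpure x y) =
  \sum_(p <- swd x) \sum_(q <- swd y) tpure (ocls p.1 q.2) (ocls p.2 q.1).
Proof.
rewrite /ocomul0 /= tmapE !swdE tpure_suml linear_sum; apply: eq_bigr => p _ /=.
by rewrite tpure_sumr linear_sum; apply: eq_bigr => q _ /=; rewrite oshufE.
Qed.

Lemma ocomul0M_sw x1 x2 y1 y2 b :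
  \sum_(p <- swd b) \sum_(q <- swd p.1) \sum_(t <- swd p.2)
     tpure (ocls (x1 * q.1) (y2 * t.2)) (ocls (x2 * q.2) (y1 * t.1)) =
  (counit b : k) *: tpure (ocls x1 y2) (ocls x2 y1).
Proof.
have lin1 (x v w : B) a : x * (a *: v + w) = a *: (x * v) + x * w.
  by rewrite mulrDr scalerAr.
rewrite (sw_assoc (F := fun u v c => \sum_(t <- swd c)
   tpure (ocls (x1 * u) (y2 * t.2)) (ocls (x2 * v) (y1 * t.1)))); first last.
- move=> u v; apply: (@sw_linear k B _ (fun c d => tpure (ocls (x1 * u) (y2 * d)) (ocls (x2 * v) (y1 * c)))).
  by split=> *; rewrite lin1 ?oclsPr ?tpurePl ?tpurePr.
- move=> u c a v v'; rewrite scaler_sumr -big_split; apply: eq_bigr => t _ /=.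
  by rewrite lin1 // oclsPl tpurePr.
- move=> v c a u u'; rewrite scaler_sumr -big_split; apply: eq_bigr => t _ /=.
  by rewrite lin1 // oclsPl tpurePl.
transitivity (\sum_(p <- swd b) tpure (ocls (x1 * p.1) (y2 * p.2)) (ocls x2 y1)); last first.
  by rewrite -tpure_suml ocls_sw tpureZl.
apply: eq_bigr => p _.
rewrite -(sw_assoc (F := fun u v w =>
   tpure (ocls (x1 * p.1) (y2 * w)) (ocls (x2 * u) (y1 * v)))); first last.
- by move=> u v a w w'; rewrite lin1 // oclsPr tpurePl.
- by move=> u w a v v'; rewrite lin1 // oclsPr tpurePr.
- by move=> v w a u u'; rewrite lin1 // oclsPl tpurePr.
under eq_bigr => q _ do rewrite -tpure_sumr ocls_sw tpureZr -tpureZl -oclsZr scalerAr.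
by rewrite -tpure_suml -ocls_sumr -mulr_sumr sw_counitl.
Qed.

Fact ocomul_subproof u : u \in span oslash_gen -> ocomul0 u = 0.
Proof.
move=> h; apply: (@span_lker _ _ _ oslash_gen (@ocomul0)) h => _ [t [b [b0 ->]]] /=.
elim/tens_ind: t => [|x y t IH]; first by rewrite mul0r linear0.
rewrite mulrDl linearD /= {}IH addr0 {t} [comul b]swdE mulr_sumr linear_sum.
transitivity (\sum_(r <- swd x) \sum_(s <- swd y)
  (counit b : k) *: tpure (ocls r.1 s.2) (ocls r.2 s.1)); last first.
  by rewrite big1 // => r _; rewrite big1 // => s _; rewrite b0 scale0r.
under [RHS]eq_bigr do under eq_bigr do rewrite -ocomul0M_sw.
under [RHS]eq_bigr do rewrite exchange_big.
rewrite [RHS]exchange_big; apply: eq_bigr => p _ /=.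
rewrite tensM /ocomul0 /= tmapE !comulM !swdE mulr_suml tpure_suml linear_sum.
apply: eq_bigr => r _ /=.
rewrite mulr_suml tpure_sumr linear_sum; apply: eq_bigr => s _ /=.
rewrite mulr_sumr tpure_suml linear_sum; apply: eq_bigr => q _ /=.
rewrite mulr_sumr tpure_sumr linear_sum; apply: eq_bigr => z _ /=.
by rewrite !tensM oshufE.
Qed.
Definition ocomul : oslash -> tens oslash oslash := lquot_lift ocomul_subproof.
Fact ocomul_linear : linear ocomul. Proof. exact: linearP. Qed.
HB.instance Definition _ :=
  GRing.isLinear.Build k oslash (tens oslash oslash) _ ocomul ocomul_linear.

Lemma ocomulE x y : ocomul (ocls x y) =
  \sum_(p <- swd x) \sum_(q <- swd y) tpure (ocls p.1 q.2) (ocls p.2 q.1).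
Proof. by rewrite -ocomul0E; exact: lquot_liftE. Qed.

Fact ocomulA q :
  tassoc (tmap ocomul idfun (ocomul q)) = tmap idfun ocomul (ocomul q).
Proof.
elim/ocls_ind: q => [|x y t IH]; first by rewrite !linear0.
rewrite !linearD /= {}IH; congr (_ + _).
pose G (a1 a2 a3 b1 b2 b3 : B) : tens oslash (tens oslash oslash) :=
  tpure (ocls a1 b3) (tpure (ocls a2 b2) (ocls a3 b1)).
transitivity (\sum_(p <- swd x) \sum_(r <- swd p.1)
    \sum_(q <- swd y) \sum_(s <- swd q.2) G r.1 r.2 p.2 q.1 s.1 s.2).
  rewrite ocomulE linear_sum [LHS]linear_sum; apply: eq_bigr => p _ /=.
  rewrite exchange_big linear_sum [LHS]linear_sum; apply: eq_bigr => q _ /=.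
  rewrite tmapE /= ocomulE tpure_suml linear_sum; apply: eq_bigr => r _ /=.
  rewrite tpure_suml linear_sum; apply: eq_bigr => s _ /=.
  by rewrite tassocE.
transitivity (\sum_(p <- swd x) \sum_(r <- swd p.2)
    \sum_(q <- swd y) \sum_(s <- swd q.1) G p.1 r.1 r.2 s.1 s.2 q.2); last first.
  rewrite ocomulE [RHS]linear_sum; apply: eq_bigr => p _ /=.
  rewrite exchange_big [RHS]linear_sum; apply: eq_bigr => q _ /=.
  rewrite tmapE /= ocomulE tpure_sumr; apply: eq_bigr => r _ /=.
  by rewrite tpure_sumr.
rewrite (sw_assoc (F := fun u v w =>
  \sum_(q <- swd y) \sum_(s <- swd q.2) G u v w q.1 s.1 s.2)); first last.
- move=> u v a w w'; rewrite scaler_sumr -big_split; apply: eq_bigr => q _ /=.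
  rewrite scaler_sumr -big_split; apply: eq_bigr => s _ /=.
  by rewrite /G oclsPl !tpurePr.
- move=> u w a v v'; rewrite scaler_sumr -big_split; apply: eq_bigr => q _ /=.
  rewrite scaler_sumr -big_split; apply: eq_bigr => s _ /=.
  by rewrite /G oclsPl tpurePl tpurePr.
- move=> v w a u u'; rewrite scaler_sumr -big_split; apply: eq_bigr => q _ /=.
  rewrite scaler_sumr -big_split; apply: eq_bigr => s _ /=.
  by rewrite /G oclsPl tpurePl.
apply: eq_bigr => p _; apply: eq_bigr => r _; apply/esym.
apply: (sw_assoc (F := fun u v w => G p.1 r.1 r.2 u v w)).
- by move=> v w a u u'; rewrite /G oclsPr !tpurePr.
- by move=> u w a v v'; rewrite /G oclsPr tpurePl tpurePr.
- by move=> u v a w w'; rewrite /G oclsPr tpurePl.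
Qed.

Fact ocounitl q : tlunit (tmap ocounit idfun (ocomul q)) = q.
Proof.
elim/ocls_ind: q => [|x y t IH]; first by rewrite !linear0.
rewrite !linearD /= {}IH; congr (_ + _).
rewrite ocomulE linear_sum linear_sum -[x in RHS]sw_counitl ocls_suml.
apply: eq_bigr => p _ /=; rewrite oclsZl -[y in RHS]sw_counitr ocls_sumr scaler_sumr.
rewrite linear_sum linear_sum; apply: eq_bigr => q _ /=.
by rewrite tmapE /= tlunitE ocounitE oclsZr scalerA.
Qed.

Fact ocounitr q : trunit (tmap idfun ocounit (ocomul q)) = q.
Proof.
elim/ocls_ind: q => [|x y t IH]; first by rewrite !linear0.
rewrite !linearD /= {}IH; congr (_ + _).
rewrite ocomulE linear_sum linear_sum -[x in RHS]sw_counitr ocls_suml.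
apply: eq_bigr => p _ /=; rewrite oclsZl -[y in RHS]sw_counitl ocls_sumr scaler_sumr.
rewrite linear_sum linear_sum; apply: eq_bigr => q _ /=.
by rewrite tmapE /= trunitE ocounitE oclsZr scalerA.
Qed.

HB.instance Definition _ :=
  isCoalgebra.Build k oslash ocomulA ocounitl ocounitr.

Definition iB (b : B) : oslash := ocls b 1.
Fact iB_linear : linear iB.
Proof. by move=> a x y; rewrite /iB oclsPl. Qed.
HB.instance Definition _ := GRing.isLinear.Build k B oslash _ iB iB_linear.
End Oslash.

Section Kernel.
Variables (k : fieldType) (V W : lmodType k) (f : {linear V -> W}).

Definition kerl : {pred V} := fun x => f x == 0.
Fact kerl_closed : subsemimod_closed kerl.
Proof.
split; [split|]; rewrite ?unfold_in; first by rewrite linear0.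
- by move=> x y; rewrite !unfold_in linearD /= => /eqP-> /eqP->; rewrite addr0.
- by move=> a x; rewrite !unfold_in linearZ /= => /eqP->; rewrite scaler0.
Qed.
HB.instance Definition _ := GRing.isSubmodClosed.Build k V kerl kerl_closed.
End Kernel.

Section Mulm.
Variables (k : fieldType) (A : algType k).
Fact mulmap_subproof : bilin (fun x y : A => x * y).
Proof.
by split=> [y a x x'|x a y y']; [rewrite mulrDl scalerAl | rewrite mulrDr scalerAr].
Qed.
Definition mulmap : tens A A -> A := tlift mulmap_subproof.
HB.instance Definition _ := GRing.Linear.on mulmap.
Lemma mulmapE x y : mulmap (tpure x y) = x * y.
Proof. exact: tliftE. Qed.
End Mulm.

Section CoalgMap.
Variables (k : fieldType) (C D : coalgType k).

Definition is_coalg_map (f : {linear C -> D}) : Prop :=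
  (forall x, comul (f x) = tmap f f (comul x)) /\
  (forall x, counit (f x) = counit x).
End CoalgMap.

(* two-sided ideal and coideal; biideal_comul reads
   comul I <= I (x) B + B (x) I *)
Record biideal (k : fieldType) (B : bialgType k) (I : submodClosed B) : Prop := {
  biidealMl : forall a x, x \in I -> a * x \in I;
  biidealMr : forall a x, x \in I -> x * a \in I;
  biideal_comul : forall x, x \in I ->
    comul x \in span [set u | exists y z,
      (y \in I \/ z \in I) /\ u = tpure y z]%classic;
  biideal_counit : forall x, x \in I -> counit x = 0;
}.

Section BialgQuotient.
Variables (k : fieldType) (B : bialgType k) (I : submodClosed B).
Hypothesis hI : biideal I.

Definition biquot of biideal I : Type := lquot I.
Local Notation Q := (biquot hI).
HB.instance Definition _ := GRing.Lmodule.on Q.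

Definition biquot_pi : B -> Q := lpi I.
Fact biquot_pi_linear : linear biquot_pi. Proof. exact: linearP. Qed.
HB.instance Definition _ := GRing.isLinear.Build k B Q _ biquot_pi biquot_pi_linear.

Lemma biquot_pi_onto (q : Q) : exists x, biquot_pi x = q.
Proof. exact: lpi_onto. Qed.
Lemma biquot_pi_eq0 x : biquot_pi x = 0 <-> x \in I.
Proof. exact: lpi_eq0. Qed.
Lemma biquot_pi_eq x y : biquot_pi x = biquot_pi y <-> x - y \in I.
Proof. exact: lpi_eq. Qed.

Let rp (q : Q) : B := projT1 (cid (biquot_pi_onto q)).
Let rpK q : biquot_pi (rp q) = q. Proof. exact: projT2 (cid (biquot_pi_onto q)). Qed.

Definition biquot_mul (p q : Q) : Q := biquot_pi (rp p * rp q).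

Lemma biquot_mulE x y : biquot_mul (biquot_pi x) (biquot_pi y) = biquot_pi (x * y).
Proof.
apply/biquot_pi_eq; rewrite -[_ * _](subrK (rp (biquot_pi x) * y)) -mulrBr -addrA -mulrBl.
apply: rpredD; [apply: (biidealMl hI) | apply: (biidealMr hI)];
  by apply/biquot_pi_eq; rewrite rpK.
Qed.

Fact biquot_mulA : associative biquot_mul.
Proof.
move=> p q r; have [x <-] := biquot_pi_onto p; have [y <-] := biquot_pi_onto q.
by have [z <-] := biquot_pi_onto r; rewrite !biquot_mulE mulrA.
Qed.
Fact biquot_mul1l : left_id (biquot_pi 1) biquot_mul.
Proof. by move=> p; have [x <-] := biquot_pi_onto p; rewrite biquot_mulE mul1r. Qed.
Fact biquot_mul1r : right_id (biquot_pi 1) biquot_mul.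
Proof. by move=> p; have [x <-] := biquot_pi_onto p; rewrite biquot_mulE mulr1. Qed.
Fact biquot_mulDl : left_distributive biquot_mul +%R.
Proof.
move=> p q r; have [x <-] := biquot_pi_onto p; have [y <-] := biquot_pi_onto q.
have [z <-] := biquot_pi_onto r.
by rewrite -linearD !biquot_mulE -linearD mulrDl.
Qed.
Fact biquot_mulDr : right_distributive biquot_mul +%R.
Proof.
move=> p q r; have [x <-] := biquot_pi_onto p; have [y <-] := biquot_pi_onto q.
have [z <-] := biquot_pi_onto r.
by rewrite -linearD !biquot_mulE -linearD mulrDr.
Qed.
Fact biquot_1_neq0 : biquot_pi 1 != 0.
Proof.
apply/eqP => /biquot_pi_eq0 /(biideal_counit hI) /eqP.
by rewrite counit1 (negPf (oner_neq0 k)).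
Qed.
HB.instance Definition _ := GRing.Zmodule_isNzRing.Build Q
  biquot_mulA biquot_mul1l biquot_mul1r biquot_mulDl biquot_mulDr biquot_1_neq0.

Lemma biquot_piM x y : biquot_pi (x * y) = biquot_pi x * biquot_pi y.
Proof. by rewrite [RHS]biquot_mulE. Qed.
Fact biquot_pi_monoid : monoid_morphism biquot_pi.
Proof. by split=> // x y; exact: biquot_piM. Qed.
HB.instance Definition _ := GRing.isMonoidMorphism.Build B Q biquot_pi biquot_pi_monoid.

Fact biquot_scaleAl (a : k) (p q : Q) : a *: (p * q) = (a *: p) * q.
Proof.
have [x <-] := biquot_pi_onto p; have [y <-] := biquot_pi_onto q.
by rewrite -biquot_piM -!linearZ /= -biquot_piM scalerAl.
Qed.
HB.instance Definition _ := GRing.Lmodule_isLalgebra.Build k Q biquot_scaleAl.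
Fact biquot_scaleAr (a : k) (p q : Q) : a *: (p * q) = p * (a *: q).
Proof.
have [x <-] := biquot_pi_onto p; have [y <-] := biquot_pi_onto q.
by rewrite -biquot_piM -!linearZ /= -biquot_piM scalerAr.
Qed.
HB.instance Definition _ := GRing.Lalgebra_isAlgebra.Build k Q biquot_scaleAr.

Fact biquot_comul_subproof x : x \in I -> (tmap biquot_pi biquot_pi \o comul) x = 0.
Proof.
move=> /(biideal_comul hI) h.
apply: (@span_lker k _ _ _ (tmap biquot_pi biquot_pi)) h => _ [y [z [yzI ->]]] /=.
rewrite tmapE /=.
by case: yzI => /biquot_pi_eq0 ->; rewrite ?tpure0l ?tpure0r.
Qed.
Definition biquot_comul : Q -> tens Q Q := lquot_lift biquot_comul_subproof.
Fact biquot_comul_linear : linear biquot_comul. Proof. exact: linearP. Qed.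
HB.instance Definition _ :=
  GRing.isLinear.Build k Q (tens Q Q) _ biquot_comul biquot_comul_linear.
Lemma biquot_comulE x : biquot_comul (biquot_pi x) = tmap biquot_pi biquot_pi (comul x).
Proof. exact: lquot_liftE. Qed.

Definition biquot_counit : Q -> k^o := lquot_lift (biideal_counit hI).
Fact biquot_counit_linear : linear biquot_counit. Proof. exact: linearP. Qed.
HB.instance Definition _ :=
  GRing.isLinear.Build k Q k^o _ biquot_counit biquot_counit_linear.
Lemma biquot_counitE x : biquot_counit (biquot_pi x) = counit x.
Proof. exact: lquot_liftE. Qed.

Fact biquot_comulA q :
  tassoc (tmap biquot_comul idfun (biquot_comul q)) =
  tmap idfun biquot_comul (biquot_comul q).
Proof.
have [x <-] := biquot_pi_onto q; rewrite biquot_comulE {q}.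
rewrite swdE !linear_sum /=.
transitivity (\sum_(p <- swd x) \sum_(q <- swd p.1)
    tpure (biquot_pi q.1) (tpure (biquot_pi q.2) (biquot_pi p.2))).
  apply: eq_bigr => p _; rewrite !tmapE /= biquot_comulE swdE.
  rewrite linear_sum tpure_suml linear_sum; apply: eq_bigr => q _ /=.
  by rewrite tmapE tassocE.
rewrite (sw_assoc (F := fun u v w => tpure (biquot_pi u) (tpure (biquot_pi v) (biquot_pi w)))).
- apply: eq_bigr => p _; rewrite !tmapE /= biquot_comulE swdE.
  by rewrite linear_sum tpure_sumr; apply: eq_bigr => q _ /=; rewrite tmapE.
- by move=> v w a u u'; rewrite linearP tpurePl.
- by move=> u w a v v'; rewrite linearP tpurePl tpurePr.
- by move=> u v a w w'; rewrite linearP !tpurePr.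
Qed.

Fact biquot_counitl q : tlunit (tmap biquot_counit idfun (biquot_comul q)) = q.
Proof.
have [x <-] := biquot_pi_onto q; rewrite biquot_comulE -[x in RHS]sw_counitl swdE.
rewrite !linear_sum; apply: eq_bigr => p _ /=.
by rewrite !tmapE /= tlunitE biquot_counitE linearZ.
Qed.
Fact biquot_counitr q : trunit (tmap idfun biquot_counit (biquot_comul q)) = q.
Proof.
have [x <-] := biquot_pi_onto q; rewrite biquot_comulE -[x in RHS]sw_counitr swdE.
rewrite !linear_sum; apply: eq_bigr => p _ /=.
by rewrite !tmapE /= trunitE biquot_counitE linearZ.
Qed.
HB.instance Definition _ :=
  isCoalgebra.Build k Q biquot_comulA biquot_counitl biquot_counitr.

Fact biquot_comulM (p q : Q) :
  (comul (p * q) : tens Q Q) = comul p * comul q.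
Proof.
have [x <-] := biquot_pi_onto p; have [y <-] := biquot_pi_onto q.
have cE z : comul (biquot_pi z : Q) = tmap biquot_pi biquot_pi (comul z) by exact: biquot_comulE.
rewrite -biquot_piM !cE comulM; elim/tens_ind: (comul x) => [|a b s IH].
  by rewrite mul0r !linear0 mul0r.
rewrite mulrDl !linearD /= mulrDl {}IH; congr (_ + _).
elim/tens_ind: (comul y) => [|c d t IH]; first by rewrite mulr0 !linear0 mulr0.
by rewrite mulrDr !linearD /= mulrDr {}IH tensM !tmapE tensM /= !biquot_piM.
Qed.
Fact biquot_comul1 : comul (1 : Q) = 1 :> tens Q Q.
Proof. by rewrite [LHS]biquot_comulE comul1 tmapE. Qed.
Fact biquot_counitM (p q : Q) : counit (p * q) = counit p * counit q.
Proof.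
have [x <-] := biquot_pi_onto p; have [y <-] := biquot_pi_onto q.
have cE z : counit (biquot_pi z : Q) = counit z by exact: biquot_counitE.
by rewrite -biquot_piM !cE counitM.
Qed.
Fact biquot_counit1 : counit (1 : Q) = 1.
Proof. by rewrite [LHS]biquot_counitE counit1. Qed.
HB.instance Definition _ := isBialgebra.Build k Q
  biquot_comulM biquot_comul1 biquot_counitM biquot_counit1.

Lemma biquot_pi_coalg_map : is_coalg_map biquot_pi.
Proof. by split=> x; [exact: biquot_comulE | exact: biquot_counitE]. Qed.
End BialgQuotient.

(* S * id = id * S = u o counit for the convolution product. *)
Definition is_antipode (k : fieldType) (H : bialgType k) (S : {linear H -> H}) : Prop :=
  forall x, mulmap (tmap S idfun (comul x)) = (counit x : k) *: 1 /\
            mulmap (tmap idfun S (comul x)) = (counit x : k) *: 1.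

(* Compatibility with the antipodes is part of the definition, although it is
   automatic for bialgebra maps. *)
Definition is_hopf_map (k : fieldType) (H K : bialgType k)
    (S : {linear H -> H}) (T : {linear K -> K}) (g : {lrmorphism H -> K}) : Prop :=
  is_coalg_map g /\ forall x, g (S x) = T (g x).

(* A Hopf algebra is a bialgebra K with an antipode T. *)
Definition is_hopf_envelope (k : fieldType) (B H : bialgType k)
    (S : {linear H -> H}) (eta : {lrmorphism B -> H}) : Prop :=
  [/\ is_antipode S, is_coalg_map eta &
    forall (K : bialgType k) (T : {linear K -> K}) (f : {lrmorphism B -> K}),
      is_antipode T -> is_coalg_map f ->
      exists g : {lrmorphism H -> K},
        [/\ is_hopf_map S T g, forall b, g (eta b) = f b &
          forall g' : {lrmorphism H -> K},
            is_hopf_map S T g' -> (forall b, g' (eta b) = f b) -> g' =1 g]].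

Definition principal_left_ideal (R : nzRingType) (a : R) : set R :=
  range (fun x => x * a).

Definition right_perfect (R : nzRingType) : Prop :=
  forall a : nat -> R,
    (forall n, principal_left_ideal (a n.+1) `<=` principal_left_ideal (a n))%classic ->
    exists N, forall n, (N <= n)%N ->
      principal_left_ideal (a n) = principal_left_ideal (a N).

Definition finite_dimensional (k : fieldType) (V : lmodType k) : Prop :=
  exists n, inhabited (Vector.axiom n V).

(* Main.v *)
From HB Require Import structures.
Require Import Defs.
From mathcomp Require Import all_boot all_algebra.
From mathcomp Require Import boolp classical_sets.

Set Implicit Arguments.
Unset Strict Implicit.
Unset Printing Implicit Defensive.

Import GRing.Theory.
Local Open Scope ring_scope.
Local Open Scope classical_set_scope.

(** Write x / y for the class [ocls x y] in X = [oslash B], i for [iB], so that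
    i x = x / 1, and I for the kernel of i. X carries two commuting left actions
    of B, one on each factor, and satisfies x b_1 / y b_2 = eps(b) x / y.

    The quotient B/I will be a Hopf algebra as soon as the classes 1 / z can be
    moved to the other side: if 1 / z = S(z) / 1, then z_1 S(z_2) / 1 =
    z_1 / z_2 = eps(z) 1 / 1, so that S is a right antipode modulo I; and if
    also z / 1 = 1 / R(z), then acting on x in I gives
    xz / 1 = x / R(z) = R(z).(x / 1) = 0, so the left ideal I is two-sided.

    To move 1 / z, take a finite family c in B spanning an X-subcomodule, with
    coefficient matrix D over B: (i (x) 1) Delta(c_i) = sum_j i(D_ij) (x) c_j.
    In a right perfect ring D^n = s D^(n+1) for some n and s
    ([right_perfect_mx]), so (s D - 1) D^n = 0. Right multiplication by D can be
    cancelled modulo I ([iB_row_cancel]): if p D has entries in I, let the second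
    factors of the tensors sum_j (p D)_j / 1 (x) c_j = 0 act on X; the relations
    of X turn this into sum_i p_i / 1 (x) c_i = 0. Hence s D = 1 modulo I, and
      1 / c_i = sum_j (s D)_ij / c_j = sum_j eps(c_j) s_ij / 1
    ([ocls1_iB]). When z is in I the c_j can be chosen in I, where eps vanishes,
    so 1 / z = 0: this makes S well defined on B/I. The statement about z / 1 is
    the same one for the co-opposite bialgebra ([iB_ocls1]).

    Finally B/I is right perfect too, and over a right perfect ring a right
    inverse of a square matrix is also a left inverse, so the right antipode S
    is an antipode ([right_antipode_antipode]). For the universal property, a
    bialgebra map f from B to a Hopf algebra with antipode T extends to
    x / y |-> f(x) T(f(y)) on X, so it kills I ([iB_eq0_hopf]). *)

(** * Descending chains over right perfect rings *)

Section FgChains.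
Variables (R : nzRingType) (M : lmodType R).
Implicit Types (N U : set M) (s : seq M).

(** Membership of 0 is kept apart because the union of an empty chain, which the
    use of the lemma of Zorn below has to accept, is empty. *)
Definition linclosed U := forall a x y, U x -> U y -> U (a *: x + y).
Definition submodule N := N 0 /\ linclosed N.

Definition lspan s : set M :=
  [set v | forall N, submodule N -> (forall x, x \in s -> N x) -> N v].

Definition fg N := exists s, N = lspan s.

(** Stationarity at one index, for every chain, is equivalent to the descending
    chain condition, and is the form in which it is consumed. *)
Definition fg_dcc U := forall N : nat -> set M,
  (forall n, fg (N n)) -> (forall n, N n.+1 `<=` N n) -> N 0%N `<=` U ->
  exists n, N n `<=` N n.+1.

Lemma linclosed0 U x : linclosed U -> U x -> U 0.
Proof. by move=> cU Ux; have := cU (-1) x x Ux Ux; rewrite scaleN1r addNr. Qed.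

Lemma submoduleZ N a x : submodule N -> N x -> N (a *: x).
Proof. by move=> [N0 cN] Nx; have := cN a x 0 Nx N0; rewrite addr0. Qed.

Lemma submoduleD N x y : submodule N -> N x -> N y -> N (x + y).
Proof. by move=> [N0 cN] Nx Ny; have := cN 1 x y Nx Ny; rewrite scale1r. Qed.

Lemma submoduleB N x y : submodule N -> N x -> N y -> N (x - y).
Proof.
by move=> sN Nx Ny; apply: submoduleD => //; rewrite -scaleN1r; exact: submoduleZ.
Qed.

Lemma lspan_submodule s : submodule (lspan s).
Proof.
split=> [N [] //|a x y sx sy N sN Ns]; apply: (proj2 sN); [exact: sx|exact: sy].
Qed.

Lemma lspan_gen s x : x \in s -> lspan s x.
Proof. by move=> xs N _; exact. Qed.

Lemma lspan_sub s N : submodule N -> (forall x, x \in s -> N x) -> lspan s `<=` N.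
Proof. by move=> sN Ns v; exact. Qed.

Lemma linclosed_bigcup (F : set (set M)) :
  (forall U, F U -> linclosed U) -> total_on F subset ->
  linclosed (\bigcup_(U in F) U).
Proof.
move=> cF totF a x y [U FU Ux] [V FV Vy].
by case: (totF _ _ FU FV) => UV; [exists V|exists U] => //; apply: cF => //; exact: UV.
Qed.

Lemma chain_seq (F : set (set M)) s (x : M) : total_on F subset ->
  (forall y, y \in x :: s -> exists2 U, F U & U y) ->
  exists2 U, F U & forall y, y \in x :: s -> U y.
Proof.
move=> totF; elim: s x => [|z s IH] x Fs.
  have [U FU Ux] := Fs x (mem_head _ _).
  by exists U => // y; rewrite inE => /eqP->.
have [U FU Us] := IH z (fun y ys => Fs y (mem_behead (s := x :: _) ys)).
have [V FV Vx] := Fs x (mem_head _ _).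
case: (totF _ _ FU FV) => UV; [exists V|exists U] => // y; rewrite inE => /predU1P[->|ys] //.
- exact/UV/Us.
- exact: UV.
- exact: Us.
Qed.

(** A finitely generated submodule of the union of a chain lies in one member. *)
Lemma fg_dcc_bigcup (F : set (set M)) :
  (forall U, F U -> linclosed U /\ fg_dcc U) -> total_on F subset ->
  fg_dcc (\bigcup_(U in F) U).
Proof.
move=> hF totF N fgN decN N0F.
have [[|x s] N0E] := fgN 0%N.
  exists 0%N; rewrite {}N0E => v /(_ [set 0]) -> //.
    by have [t ->] := fgN 1%N; exact: (lspan_submodule t).1.
  by split=> // a x y -> ->; rewrite scaler0 addr0.
have [|U FU Us] := @chain_seq F s x totF.
  by move=> y ys; apply: N0F; rewrite N0E; exact: lspan_gen.
have [cU dU] := hF _ FU; apply: (dU N) => //; rewrite N0E; apply: lspan_sub => //.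
by split=> //; apply: (linclosed0 cU (Us _ (mem_head _ _))).
Qed.

Hypothesis perfR : right_perfect R.

(** The condition on principal left ideals passes to cyclic submodules of any
    module: write y_n = a_n y_0 with a_n = r_(n-1) ... r_0 and use the chain of
    the left ideals R a_n. *)
Lemma cyclic_dcc (r : nat -> R) (y : nat -> M) :
  (forall n, y n.+1 = r n *: y n) -> exists n t, y n = t *: y n.+1.
Proof.
move=> yS; pose a n := iteri n (fun i b => r i * b) 1.
have yE n : y n = a n *: y 0%N.
  by elim: n => [|n IH]; rewrite ?scale1r // yS IH scalerA.
have [n v [x _ <-]|N aN] := perfR (a := a).
  by exists (x * r n) => //; rewrite -mulrA.
have: principal_left_ideal (a N.+1) (a N).
  by rewrite (aN _ (leqnSn N)); exists 1; rewrite ?mul1r.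
by move=> [t _ ta]; exists N, t; rewrite yE -ta -scalerA -yE.
Qed.

(** R y is minimal among the cyclic submodules not contained in U. *)
Definition minimal_outside U y := ~ U y /\ forall r, ~ U (r *: y) -> exists t, y = t *: (r *: y).

(** Otherwise a strictly descending chain of cyclic submodules could be built by
    dependent choice. *)
Lemma exists_minimal_outside N U : (forall r x, N x -> N (r *: x)) ->
  (exists2 y, N y & ~ U y) -> exists2 y, N y & minimal_outside U y.
Proof.
move=> NZ [y0 Ny0 Uy0]; apply: contrapT => nomin.
pose T := {y | N y /\ ~ U y}.
have step (y : T) : {r | ~ U (r *: sval y) /\ forall t, sval y <> t *: (r *: sval y)}.
  case: y => y [Ny Uy] /=; apply: cid; apply: contrapT => hr; apply: nomin; exists y => //.
  split=> // r Ur; apply: contrapT => ht; apply: hr; exists r; split=> // t yt.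
  by apply: ht; exists t.
pose nxt (y : T) : T := exist _ (sval (step y) *: sval y)
  (conj (NZ _ _ (svalP y).1) (svalP (step y)).1).
pose Y n : T := iter n nxt (exist _ y0 (conj Ny0 Uy0)).
have [n [t]] := @cyclic_dcc (fun n => sval (step (Y n))) (fun n => sval (Y n)) (fun n => erefl).
exact: (svalP (step (Y n))).2.
Qed.

(** If some N_n lies in U, the condition on U applies. Otherwise each N_n has
    an element y_n with R y_n minimal outside U. Minimality of R m allows one to
    correct the generators of N_n by multiples of y_n so that they fall in U:
    N_n = F_n + R y_n with F_n in U; minimality of R y_n shows that y_n may be
    replaced by y_(n+1), so that F_(n+1) can be chosen inside F_n. The F_n are
    stationary, hence so are the N_n. *)
Lemma fg_dcc_extend U m : submodule U -> fg_dcc U -> minimal_outside U m ->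
  fg_dcc [set v | exists r, U (v - r *: m)].
Proof.
move=> sU dU [Um minm] N fgN decN N0U.
have sN n : submodule (N n) by have [s ->] := fgN n; exact: lspan_submodule.
have NU n v : N n v -> exists r, U (v - r *: m).
  by elim: n v => [|n IH] v Nv; [exact: N0U | apply/IH/decN].
have [[n NnU]|noU] := pselect (exists n, N n `<=` U).
  have [//||p] := dU (fun p => N (n + p)%N) (fun p => fgN _) _ _.
  - by move=> p; rewrite addnS.
  - by rewrite addn0.
  by rewrite addnS; exists (n + p)%N.
have min_y n : {y | N n y /\ minimal_outside U y}.
  apply: cid; have [||y] := @exists_minimal_outside (N n) U; last by exists y.
  - by move=> r x; apply: submoduleZ.
  - apply: contrapT => hn; apply: noU; exists n => x Nx; apply: contrapT => Ux.
    by apply: hn; exists x.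
pose y n := sval (min_y n).
have Ny n : N n (y n) by exact: (svalP (min_y n)).1.
have Uy n : ~ U (y n) by exact: (svalP (min_y n)).2.1.
have miny n : forall r, ~ U (r *: y n) -> exists t, y n = t *: (r *: y n).
  exact: (svalP (min_y n)).2.2.
pose inv n (F : set M) := [/\ fg F, F `<=` N n, F `<=` U &
  forall v, N n v -> exists t, F (v - t *: y n)].
have refine n (F : set M) : submodule F -> F `<=` U ->
    (forall v, N n v -> exists t, F (v - t *: y n)) ->
    exists2 F', inv n F' & F' `<=` F.
  move=> sF FU NF; have [s Ns] := fgN n.
  have /choice[t ht] : forall v, exists t, N n v -> F (v - t *: y n).
    move=> v; have [/NF[t]|] := pselect (N n v); first by exists t.
    by exists 0.
  pose s' := [seq v - t v *: y n | v <- s].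
  have s'F : lspan s' `<=` F.
    apply: lspan_sub => // _ /mapP[v vs ->]; apply: ht; rewrite Ns; exact: lspan_gen.
  exists (lspan s') => //; split.
  - by exists s'.
  - apply: lspan_sub => // _ /mapP[v vs ->]; apply: submoduleB => //.
      by rewrite Ns; exact: lspan_gen.
    exact: submoduleZ.
  - exact: subset_trans s'F FU.
  - suff: N n `<=` [set v | exists t, lspan s' (v - t *: y n)] by [].
    rewrite {1}Ns; apply: lspan_sub.
      split; first by exists 0; rewrite scale0r subr0; exact: (lspan_submodule s').1.
      move=> a v1 v2 [t1 h1] [t2 h2]; exists (a * t1 + t2).
      have -> : a *: v1 + v2 - (a * t1 + t2) *: y n =
                a *: (v1 - t1 *: y n) + (v2 - t2 *: y n).
        by rewrite scalerBr scalerDl scalerA opprD addrACA.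
      exact: (lspan_submodule s').2.
    by move=> x xs; exists (t x); apply: lspan_gen; apply/mapP; exists x.
have inv0 : exists F, inv 0%N F.
  have [|F invF _] := refine 0%N U sU (@subset_refl _ _); last by exists F.
  move=> v /NU[r hr]; have [q hq] := NU _ _ (Ny 0%N).
  have qm : ~ U (q *: m).
    by move=> Uq; apply: (Uy 0%N); rewrite -(subrK (q *: m) (y 0%N)); apply: submoduleD.
  have [t tE] := minm _ qm; exists (r * t).
  have -> : v - (r * t) *: y 0%N = (v - r *: m) - (r * t) *: (y 0%N - q *: m).
    by rewrite scalerBr -[(r * t) *: (q *: m)]scalerA -tE opprB addrA subrK.
  by apply: submoduleB => //; apply: submoduleZ.
(* y_n can be traded for y_(n+1): y_(n+1) = f + r y_n with f in F and r y_n
   outside U, so y_n is a multiple of r y_n. *)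
have pass n F v : inv n F -> N n v -> exists t, F (v - t *: y n.+1).
  move=> [[s Fs] FN FU NF] Nv; have sF : submodule F by rewrite Fs; exact: lspan_submodule.
  have [r hr] := NF _ (decN _ _ (Ny n.+1)).
  have ry : ~ U (r *: y n).
    move=> Ur; apply: (Uy n.+1); rewrite -(subrK (r *: y n) (y n.+1)).
    by apply: submoduleD => //; exact: FU.
  have [t tE] := miny _ _ ry; have [q hq] := NF _ Nv.
  exists (q * t).
  have -> : v - (q * t) *: y n.+1 = (v - q *: y n) - (q * t) *: (y n.+1 - r *: y n).
    by rewrite scalerBr -[(q * t) *: (r *: y n)]scalerA -tE opprB addrA subrK.
  by apply: submoduleB => //; apply: submoduleZ.
have step n (F : {F | inv n F}) : {F' : {F' | inv n.+1 F'} | sval F' `<=` sval F}.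
  case: F => F invF; apply: cid; have [[s Fs] _ FU _] := invF.
  have sF : submodule F by rewrite Fs; exact: lspan_submodule.
  have [v Nv|F' iF' F'F] := refine n.+1 F sF FU _; last by exists (exist _ F' iF').
  by apply: (pass n) => //; exact: decN.
pose F := fix F n : {F | inv n F} := match n with
  | 0 => cid inv0 | n'.+1 => sval (step n' (F n')) end.
have invF n : inv n (sval (F n)) by exact: svalP.
have [n|n||n Fn] := dU (fun n => sval (F n)).
- by have [] := invF n.
- exact: (svalP (step n (F n))).
- by have [] := invF 0%N.
exists n => v Nv; have [t ht] := pass _ _ _ (invF n) Nv.
rewrite -(subrK (t *: y n.+1) v); apply: submoduleD => //.
  by have [_ FN _ _] := invF n.+1; exact/FN/Fn.
exact: submoduleZ.
Qed.

(** A theorem of Bjork: the descending chain condition on cyclic submodules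
    implies the one on finitely generated submodules. A submodule maximal for the
    latter is everything, by [fg_dcc_extend]. *)
Lemma fg_dcc_full : fg_dcc setT.
Proof.
have [F hF totF|U [[cU dU] maxU]] := @Zorn_bigcup M (fun U => linclosed U /\ fg_dcc U).
  split; last by apply: fg_dcc_bigcup.
  by apply: linclosed_bigcup => // V /hF[].
have sU : submodule U.
  split=> //; apply: contrapT => U0; apply: (maxU [set 0]).
    split=> [x Ux|]; last by move=> /(_ 0 erefl).
    by case: U0; exact: linclosed0 Ux.
  split=> [a x y -> ->|N fgN _ N0]; first by rewrite scaler0 addr0.
  exists 0%N => x /N0 ->; have [s ->] := fgN 1%N; exact: (lspan_submodule s).1.
have [UT|nUT] := pselect (forall x, U x).
  by move=> N fgN decN _; apply: dU.
have [||m _ minm] := @exists_minimal_outside setT U.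
- by [].
- by apply: contrapT => hn; apply: nUT => x; apply: contrapT => Ux; apply: hn; exists x.
have := fg_dcc_extend sU dU minm; set V := [set v | _] => dV.
case: (maxU V).
  split=> [x Ux|VU]; first by exists 0; rewrite scale0r subr0.
  by apply: minm.1; apply: VU; exists 1; rewrite scale1r subrr; case: sU.
split=> // a x y [r hr] [q hq]; exists (a * r + q).
have -> : a *: x + y - (a * r + q) *: m = a *: (x - r *: m) + (y - q *: m).
  by rewrite scalerBr scalerDl scalerA opprD addrACA.
exact: cU.
Qed.
End FgChains.

(** The submodules R^m u^n of row vectors form a descending chain of finitely
    generated left modules. *)
Lemma right_perfect_mx (R : nzRingType) (m : nat) (u : 'M[R]_m) : right_perfect R ->
  exists n s, u ^+ n = s *m u ^+ n.+1.
Proof.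
move=> perfR; pose N n : set 'rV[R]_m := range (fun p => p *m u ^+ n).
have sN n : submodule (N n).
  split; first by exists 0; rewrite ?mul0mx.
  by move=> a _ _ [p _ <-] [q _ <-]; exists (a *: p + q) => //; rewrite mulmxDl scalemxAl.
have decN n : N n.+1 `<=` N n.
  by move=> _ [p _ <-]; exists (p *m u) => //; rewrite exprS -mulmxA.
have [n|//|//|n Nn] := @fg_dcc_full R 'rV[R]_m perfR N.
  exists [seq row i (u ^+ n) | i <- enum 'I_m]; apply/seteqP; split.
    move=> _ [p _ <-] L sL hL; rewrite mulmx_sum_row.
    elim/big_ind: _ => [|x y Lx Ly|i _]; first by case: sL.
      exact: submoduleD.
    apply: submoduleZ => //; apply: hL; apply/mapP; exists i => //; exact: mem_enum.
  apply: lspan_sub => // _ /mapP[i _ ->].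
  by exists (delta_mx 0 i) => //; rewrite rowE.
have /choice[p hp] : forall i, exists p : 'rV[R]_m, row i (u ^+ n) = p *m u ^+ n.+1.
  move=> i; have [|p _ hp] := Nn (row i (u ^+ n)); last by exists p.
  by exists (delta_mx 0 i) => //; rewrite rowE.
exists n, (\matrix_(i < m) p i); apply/row_matrixP => i.
by rewrite row_mul rowK hp.
Qed.

Lemma right_perfect_quotient (R R' : nzRingType) (f : {rmorphism R -> R'}) :
  (forall y, exists x, f x = y) -> right_perfect R -> right_perfect R'.
Proof.
move=> fsurj perfR a decra.
have /choice[r hr] n : exists r, a n.+1 = f r * a n.
  have [|x _ <-] := decra n (a n.+1); first by exists 1; rewrite ?mul1r.
  by have [r <-] := fsurj x; exists r.
pose b n := iteri n (fun i b => r i * b) 1.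
have aE n : a n = f (b n) * a 0%N.
  by elim: n => [|n IH]; rewrite ?rmorph1 ?mul1r // hr IH mulrA -rmorphM.
have [n v [x _ <-]|N bN] := perfR b.
  by exists (x * r n) => //; rewrite -mulrA.
exists N => n /bN bnN; apply/seteqP; split=> _ [x _ <-].
  have: principal_left_ideal (b N) (b n) by rewrite -bnN; exists 1; rewrite ?mul1r.
  by move=> [y _ yb]; exists (x * f y) => //; rewrite -mulrA; congr (_ * _); rewrite (aE N) mulrA -rmorphM yb -aE.
have: principal_left_ideal (b n) (b N) by rewrite bnN; exists 1; rewrite ?mul1r.
by move=> [y _ yb]; exists (x * f y) => //; rewrite -mulrA; congr (_ * _); rewrite (aE n) mulrA -rmorphM yb -aE.
Qed.

(** Principal left ideals are subspaces, here encoded as row spaces of the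
    matrices of right multiplications, so their dimensions stabilise. *)
Lemma finite_dimensional_right_perfect (k : fieldType) (A : algType k) :
  finite_dimensional A -> right_perfect A.
Proof.
move=> [d [[f flin [g fK gK]]]] a decra.
pose fl : {linear A -> 'rV[k]_d} := HB.pack f (GRing.isLinear.Build k A 'rV[k]_d _ f flin).
have glin : linear g.
  by move=> c x y; apply: (can_inj fK); rewrite gK flin !gK.
pose gl : {linear 'rV[k]_d -> A} := HB.pack g (GRing.isLinear.Build k 'rV[k]_d A _ g glin).
have mlin c : linear (fun x : A => x * c).
  by move=> e x y; rewrite mulrDl scalerAl.
pose ml c : {linear A -> A} := HB.pack (fun x => x * c)
  (GRing.isLinear.Build k A A _ (fun x => x * c) (mlin c)).
pose X c := lin1_mx (fl \o ml c \o gl).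
have XE c p : p *m X c = f (g p * c) by rewrite mul_rV_lin1.
have plE c c' : principal_left_ideal c `<=` principal_left_ideal c' <-> (X c <= X c')%MS.
  split=> [cc'|/submxP[D XD] _ [x _ <-]].
    apply/row_subP => i; rewrite rowE XE.
    have [|y _ <-] := cc' (g (delta_mx 0 i) * c); first by exists (g (delta_mx 0 i)).
    by rewrite -[y]fK -XE submxMl.
  exists (g (f x *m D)) => //; apply: (can_inj fK).
  by rewrite -XE -mulmxA -XD XE fK.
have [N Nmin] : exists N, forall n, (\rank (X (a N)) <= \rank (X (a n)))%N.
  have ex : exists r, `[< exists n, r = \rank (X (a n)) >].
    by exists (\rank (X (a 0%N))); apply/asboolP; exists 0%N.
  case: (ex_minnP ex) => r /asboolP[N ->] rmin; exists N => n.
  by apply: rmin; apply/asboolP; exists n.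
exists N => n Nn.
have sub : principal_left_ideal (a n) `<=` principal_left_ideal (a N).
  elim: n Nn => [|n IH]; first by rewrite leqn0 => /eqP->.
  rewrite leq_eqVlt => /predU1P[->//|/IH]; exact: subset_trans.
apply/seteqP; split=> //; apply/plE.
have /plE XnN := sub.
by rewrite -(geq_leqif (mxrank_leqif_sup XnN)).
Qed.

(** * Tensors with dual families *)

(** A subspace K maximal among those that contain I but not w is a hyperplane,
    and V = K + k w; the functional is the coordinate along w. *)
Lemma separating_functional (k : fieldType) (V : lmodType k) (I : set V) (w : V) :
  submodule I -> ~ I w ->
  exists phi : {linear V -> k^o}, (forall x, I x -> phi x = 0) /\ phi w = 1.
Proof.
move=> sI Iw.
have [F hF totF|A [[sA Aw] maxA]] :=
    @Zorn_bigcup V (fun A => submodule (A `|` I) /\ ~ (A `|` I) w).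
  split; last by move=> [[A FA Aw]|//]; apply: (proj2 (hF _ FA)); left.
  split=> [|a x y]; first by right; exact: sI.1.
  move=> [[A FA Ax]|Ix] [[C FC Cy]|Iy].
  - case: (totF _ _ FA FC) => sub.
      have [] := (hF _ FC).1.2 a x y (or_introl (sub _ Ax)) (or_introl Cy); last by right.
      by move=> h; left; exists C.
    have [] := (hF _ FA).1.2 a x y (or_introl Ax) (or_introl (sub _ Cy)); last by right.
    by move=> h; left; exists A.
  - have [] := (hF _ FA).1.2 a x y (or_introl Ax) (or_intror Iy); last by right.
    by move=> h; left; exists A.
  - have [] := (hF _ FC).1.2 a x y (or_intror Ix) (or_introl Cy); last by right.
    by move=> h; left; exists C.
  - by right; exact: sI.2.
set K := A `|` I in sA Aw.
have spans x : exists a, K (x - a *: w).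
  have [Kx|Kx] := pselect (K x); first by exists 0; rewrite scale0r subr0.
  (* K + k x is strictly larger than K, so it contains w = v + b x with v in K. *)
  pose L := [set v | exists b, K (v - b *: x)].
  have KL v : K v -> L v by move=> Kv; exists 0; rewrite scale0r subr0.
  have Lx : L x by exists 1; rewrite scale1r subrr; exact: sA.1.
  have sL : submodule L.
    split=> [|a u v [b hb] [c hc]]; first by exact/KL/sA.1.
    exists (a * b + c).
    have -> : a *: u + v - (a * b + c) *: x = a *: (u - b *: x) + (v - c *: x).
      by rewrite scalerBr scalerDl scalerA opprD addrACA.
    exact: sA.2.
  have [b hb] : L w.
    apply: contrapT => Lw; apply: (maxA L).
      by split=> [v Av|LA]; [apply: KL; left | apply: Kx; left; exact: LA].
    by rewrite setUidl // => v Iv; apply: KL; right.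
  have b0 : b != 0.
    by apply/eqP => b0; move: hb; rewrite b0 scale0r subr0.
  exists b^-1; have -> : x - b^-1 *: w = (- b^-1) *: (w - b *: x).
    by rewrite scalerBr !scaleNr scalerA mulVf // scale1r opprK addrC.
  exact: submoduleZ.
have uniq x a b : K (x - a *: w) -> K (x - b *: w) -> a = b.
  move=> Ka Kb; apply/eqP; rewrite -subr_eq0; apply/negP => /negP ab; apply: Aw.
  have -> : w = (a - b)^-1 *: ((x - b *: w) - (x - a *: w)).
    rewrite opprB [X in _ *: X]addrC addrA subrK -scalerBl scalerA mulVf ?scale1r //.
  by apply: submoduleZ => //; exact: submoduleB.
have /choice[f hf] := spans.
have flin : linear (f : V -> k^o).
  move=> a x y; apply: (uniq (a *: x + y)) => //.
  have -> : a *: x + y - (a *: (f x : k^o) + f y) *: w = a *: (x - f x *: w) + (y - f y *: w).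
    by rewrite scalerBr scalerDl scalerA opprD addrACA.
  exact: sA.2.
pose fl : {linear V -> k^o} :=
  HB.pack (f : V -> k^o) (GRing.isLinear.Build k V k^o _ (f : V -> k^o) flin).
exists fl; split=> [x Ix|] /=; apply: uniq (hf _) _.
  by rewrite scale0r subr0; right.
by rewrite scale1r subrr; exact: sA.1.
Qed.

Section TensorEvaluation.
Variables (k : fieldType) (V W : lmodType k).

(** Contraction of one factor of a tensor by a functional. *)
Definition evl (phi : {linear V -> k^o}) : tens V W -> W :=
  @tlunit k W \o tmap phi idfun.
HB.instance Definition _ phi := GRing.Linear.on (evl phi).
Definition evr (psi : {linear W -> k^o}) : tens V W -> V :=
  @trunit k V \o tmap idfun psi.
HB.instance Definition _ psi := GRing.Linear.on (evr psi).

Lemma evlE phi v w : evl phi (tpure v w) = (phi v : k) *: w.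
Proof. by rewrite /evl /= tmapE tlunitE. Qed.
Lemma evrE psi v w : evr psi (tpure v w) = (psi w : k) *: v.
Proof. by rewrite /evr /= tmapE trunitE. Qed.
End TensorEvaluation.
Arguments evl {k V W} phi _ : simpl never.
Arguments evr {k V W} psi _ : simpl never.

Lemma tmap_comp (k : fieldType) (V V' V'' W W' W'' : lmodType k)
    (f : {linear V -> V'}) (f' : {linear V' -> V''}) (f'' : {linear V -> V''})
    (g : {linear W -> W'}) (g' : {linear W' -> W''}) (g'' : {linear W -> W''}) t :
  f' \o f =1 f'' -> g' \o g =1 g'' -> tmap f' g' (tmap f g t) = tmap f'' g'' t.
Proof.
move=> ff gg; elim/tens_ind: t => [|v w t IH]; first by rewrite !linear0.
by rewrite !linearD /= IH !tmapE -ff -gg.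
Qed.

Lemma evl_natural (k : fieldType) (V W W' : lmodType k) (phi : {linear V -> k^o})
    (f : {linear W -> W'}) t : evl phi (tmap idfun f t) = f (evl phi t).
Proof.
elim/tens_ind: t => [|v w t IH]; first by rewrite !linear0.
by rewrite !linearD /= IH tmapE !evlE linearZ.
Qed.

Lemma evr_natural (k : fieldType) (V V' W : lmodType k) (psi : {linear W -> k^o})
    (f : {linear V -> V'}) t : evr psi (tmap f idfun t) = f (evr psi t).
Proof.
elim/tens_ind: t => [|v w t IH]; first by rewrite !linear0.
by rewrite !linearD /= IH tmapE !evrE linearZ.
Qed.

Definition dual_family (k : fieldType) (V : lmodType k) (m : nat)
    (a : 'I_m -> V) (phi : 'I_m -> {linear V -> k^o}) :=
  forall i j, phi i (a j) = (i == j)%:R.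

Section MinimalTensor.
Variables (k : fieldType) (V W : lmodType k).

Lemma dual_sum m (a : 'I_m -> V) phi (U : lmodType k) (c : 'I_m -> U) i :
  dual_family a phi -> \sum_j (phi i (a j) : k) *: c j = c i.
Proof.
move=> dual; rewrite (bigD1 i) //= dual eqxx scale1r big1 ?addr0 // => j ji.
by rewrite dual eq_sym (negPf ji) scale0r.
Qed.

Definition irredundant (U : lmodType k) m (a : 'I_m -> U) :=
  forall i (b : 'I_m -> k), a i <> \sum_(j | j != i) b j *: a j.

Lemma irredundant_dual (U : lmodType k) m (a : 'I_m -> U) :
  irredundant a -> exists phi, dual_family a phi.
Proof.
move=> irr; suff h i : exists phi : {linear U -> k^o}, forall j, phi (a j) = (i == j)%:R.
  by have [phi hphi] := choice h; exists phi.
have [||phi [phi0 phi1]] := @separating_functional k U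
   [set v | exists b : 'I_m -> k, v = \sum_(j | j != i) b j *: a j] (a i).
- split=> [|x _ _ [b ->] [c ->]].
    by exists (fun=> 0); rewrite big1 // => j _; rewrite scale0r.
  exists (fun j => x * b j + c j); rewrite scaler_sumr -big_split.
  by apply: eq_bigr => j _ /=; rewrite scalerA -scalerDl.
- by move=> [b]; exact: irr.
exists phi => j; have [<-//|ij] := eqVneq; apply: phi0.
exists (fun l => (l == j)%:R); rewrite (bigD1 j) 1?eq_sym //= eqxx scale1r big1 ?addr0 //.
by move=> l /andP[_ /negPf->]; rewrite scale0r.
Qed.

(** In an expression of t with the least number of terms, no left (right) factor
    is a combination of the others, so dual functionals exist on both sides. *)
Lemma minimal_tensor (t : tens V W) : exists m (a : 'I_m -> V) (c : 'I_m -> W) phi psi,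
  [/\ t = \sum_i tpure (a i) (c i), dual_family a phi & dual_family c psi].
Proof.
pose rep m := exists (a : 'I_m -> V) (c : 'I_m -> W), t = \sum_i tpure (a i) (c i).
have ex : exists m, `[< rep m >].
  have [s tE] := tens_sum t; exists (size s); apply/asboolP.
  exists (fun i => (tnth (in_tuple s) i).1), (fun i => (tnth (in_tuple s) i).2).
  by rewrite tE big_tnth.
case: (ex_minnP ex) => m /asboolP[a [c tE]] minm.
have shorter i (a' : 'I_m -> V) (c' : 'I_m -> W) : t <> \sum_(j | j != i) tpure (a' j) (c' j).
  case: m {minm}(minm m.-1) i a' c' {a c tE} => [_ []//|m] minm i a' c' tE.
  have := ltnn m; rewrite minm //; apply/asboolP.
  exists (fun j => a' (lift i j)), (fun j => c' (lift i j)); rewrite tE.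
  rewrite (reindex_omap (lift i) (unlift i)) /=; last first.
    by move=> j; rewrite eq_sym => /unlift_some[l -> ->].
  by apply: eq_bigl => j; rewrite eq_sym neq_lift liftK eqxx.
have irra : irredundant a.
  move=> i b ai; apply: (shorter i a (fun j => c j + b j *: c i)).
  rewrite tE (bigD1 i) //= {1}ai.
  rewrite (big_morph _ (fun x y => tpureDl x y (c i)) (tpure0l _ (c i))) -big_split; apply: eq_bigr => j _ /=.
  by rewrite tpureDr tpureZr tpureZl addrC.
have irrc : irredundant c.
  move=> i b ci; apply: (shorter i (fun j => a j + b j *: a i) c).
  rewrite tE (bigD1 i) //= {1}ci.
  rewrite (big_morph _ (tpureDr (a i)) (tpure0r _ (a i))) -big_split; apply: eq_bigr => j _ /=.
  by rewrite tpureDl tpureZr tpureZl addrC.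
have [phi hphi] := irredundant_dual irra; have [psi hpsi] := irredundant_dual irrc.
by exists m, a, c, phi, psi.
Qed.
End MinimalTensor.

(** Members of a family with dual functionals are linearly independent, in the
    strong sense of tensoring with any space. *)
Lemma dual_independent (k : fieldType) (U W : lmodType k) m (c : 'I_m -> W) psi
    (p : 'I_m -> U) : dual_family c psi ->
  \sum_i tpure (p i) (c i) = 0 -> forall i, p i = 0.
Proof.
move=> dual p0 i; have := congr1 (evr (psi i)) p0.
rewrite linear0 linear_sum => <-; rewrite -[LHS](dual_sum p i dual).
by apply: eq_bigr => j _; rewrite /= evrE.
Qed.

(** Apply f to the right factor and write the result as sum a_i (x) w_i with dual
    functionals: the a_i lie in ker f, the w_i = f(y_i) come from contractions
    y_i of t, and t - sum a_i (x) y_i is killed by f on the right factor. *)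
Lemma tmap_ker (k : fieldType) (V W : lmodType k) (f : {linear V -> W}) (t : tens V V) :
  tmap f f t = 0 ->
  t \in Defs.span [set u | exists y z, (f y = 0 \/ f z = 0) /\ u = tpure y z].
Proof.
move=> ft0; have [m [a [w [phi [psi [tE dual dualw]]]]]] := minimal_tensor (tmap idfun f t).
have wE i : w i = f (evl (phi i) t).
  rewrite -(evl_natural (phi i) f) tE linear_sum -[LHS](dual_sum w i dual).
  by apply: eq_bigr => j _; rewrite /= evlE.
have fa0 : forall i, f (a i) = 0.
  move: ft0; have -> : tmap f f t = tmap f idfun (tmap idfun f t) by apply/esym/tmap_comp.
  rewrite tE linear_sum => ft0.
  apply: dual_independent dualw _; rewrite -[RHS]ft0.
  by apply: eq_bigr => i _; rewrite /= tmapE.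
pose r := t - \sum_i tpure (a i) (evl (phi i) t).
have fr0 : tmap idfun f r = 0.
  apply/eqP; rewrite linearB subr_eq0 /= tE linear_sum; apply/eqP.
  by apply: eq_bigr => i _; rewrite /= tmapE -wE.
have [m' [b [z [phi' [psi' [rE dual' _]]]]]] := minimal_tensor r.
have fz0 i : f (z i) = 0.
  have := evl_natural (phi' i) f r; rewrite fr0 linear0 => /esym.
  rewrite rE linear_sum; under eq_bigr do rewrite /= evlE.
  by rewrite dual_sum.
rewrite -(subrK (\sum_i tpure (a i) (evl (phi i) t)) t) -/r rE.
rewrite rpredD // rpred_sum // => i _; apply: mem_span.
  by exists (b i), (z i); split; first right.
by exists (a i), (evl (phi i) t); split; first left.
Qed.

(** * Coefficients of comodules *)

Lemma is_coalg_map_id (k : fieldType) (C : coalgType k) : is_coalg_map (@idfun C).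
Proof.
split=> x //=; elim/tens_ind: (comul x) => [|v w t IH]; first by rewrite linear0.
by rewrite linearD /= tmapE -IH.
Qed.

(** Every element x of C lies in a finite-dimensional left E-subcomodule of C,
    spanned by the right factors c_i of a minimal expression of
    (pi (x) 1) Delta(x) = sum a_i (x) c_i. Each c_i is a contraction of Delta(x),
    and by coassociativity the coefficients are contractions of Delta(a_j). They
    are lifted to C: since a_j = pi(a'_j), with a'_j a contraction of Delta(x)
    on the right, one may take D_ij = phi_i(pi(a'_j1)) a'_j2. *)
Lemma comodule_coefficients (k : fieldType) (C E : coalgType k) (pi : {linear C -> E}) x :
  is_coalg_map pi -> exists m (c : 'I_m -> C) psi (D : 'M[C]_m) (l : 'I_m -> k),
  [/\ dual_family c psi, x = \sum_i l i *: c i,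
      forall i, tmap pi idfun (comul (c i)) = \sum_j tpure (pi (D i j)) (c j)
    & pi x = 0 -> forall i, pi (c i) = 0].
Proof.
move=> [pi_comul pi_counit]; pose t := tmap pi idfun (comul x).
have [m [a [c [phi [psi [tE duala dualc]]]]]] := minimal_tensor t.
pose a' j := evr (psi j) (comul x).
have pia' j : pi (a' j) = a j.
  rewrite -evr_natural -/t tE linear_sum -[RHS](dual_sum a j dualc).
  by apply: eq_bigr => i _; rewrite /= evrE.
have cE i : c i = evl (phi i) t.
  rewrite tE linear_sum -[LHS](dual_sum c i duala).
  by apply: eq_bigr => j _; rewrite /= evlE.
have cx i : c i = \sum_(p <- swd x) (phi i (pi p.1) : k) *: p.2.
  rewrite cE /t swdE !linear_sum; apply: eq_bigr => p _.
  by rewrite /= tmapE evlE.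
exists m, c, psi, (\matrix_(i, j) evl (phi i \o pi) (comul (a' j))), (fun i => counit (a i)).
split=> //.
- transitivity (tlunit (tmap counit idfun t)).
    rewrite -[LHS](counitl x) /t; congr (tlunit _).
    by apply/esym/tmap_comp => // y; exact: pi_counit.
  by rewrite tE !linear_sum; apply: eq_bigr => i _; rewrite /= tmapE tlunitE.
- move=> i.
  have Flin (y z : C) : linear (fun u : C => (phi i (pi u) : k) *: tpure (pi y) z).
    by move=> b u v; rewrite !linearP scalerDl -scalerA.
  transitivity (\sum_(p <- swd x) \sum_(q <- swd p.2)
      (phi i (pi p.1) : k) *: tpure (pi q.1) q.2).
    rewrite {1}cx !linear_sum; apply: eq_bigr => p _.
    rewrite !linearZ /= swdE linear_sum scaler_sumr; apply: eq_bigr => q _.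
    by rewrite /= tmapE.
  rewrite -(sw_assoc (F := fun u v w => (phi i (pi u) : k) *: tpure (pi v) w)) //; first last.
  - by move=> u v b w w'; rewrite tpurePr scalerDr !scalerA mulrC.
  - by move=> u w b v v'; rewrite linearP tpurePl scalerDr !scalerA mulrC.
  pose G : {linear E -> E} := evl (phi i) \o comul.
  transitivity (tmap G idfun t).
    rewrite /t swdE !linear_sum; apply: eq_bigr => p _.
    rewrite /= !tmapE /= pi_comul swdE !linear_sum tpure_suml; apply: eq_bigr => q _.
    by rewrite /= tmapE evlE tpureZl.
  rewrite tE linear_sum; apply: eq_bigr => j _.
  rewrite /= tmapE mxE /= -pia' pi_comul; congr tpure.
  elim/tens_ind: (comul (a' j)) => [|v w s IH]; first by rewrite !linear0.
  by rewrite !linearD /= IH tmapE !evlE linearZ.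
- move=> pix0 i; rewrite cE -evl_natural.
  have -> : tmap idfun pi t = tmap pi pi (comul x) by apply: tmap_comp.
  by rewrite -pi_comul pix0 !linear0.
Qed.

(** Comatrix elements of a comodule: Delta(D) = D (x) D and eps(D) = 1. *)
Definition comatrix (k : fieldType) (C : coalgType k) m (D : 'M[C]_m) :=
  (forall i j, comul (D i j) = \sum_l tpure (D i l) (D l j)) /\
  (forall i j, counit (D i j) = (i == j)%:R).

(** The coefficients of a comodule with independent basis c are comatrix elements,
    and x = sum l_i c_i = sum l_i D_ij eps(c_j). *)
Lemma comatrix_span (k : fieldType) (C : coalgType k) (x : C) :
  exists m (D : 'M[C]_m) (l r : 'I_m -> k),
    comatrix D /\ x = \sum_i \sum_j (l i * r j) *: D i j.
Proof.
have [m [c [psi [D [l [dual xE cD _]]]]]] := comodule_coefficients x (is_coalg_map_id C).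
have {}cD i : comul (c i) = \sum_j tpure (D i j) (c j).
  by rewrite -[RHS]cD -(is_coalg_map_id C).1.
exists m, D, l, (fun j => counit (c j)); split; last first.
  rewrite xE; apply: eq_bigr => i _; rewrite -[c i in LHS]counitr cD !linear_sum.
  by apply: eq_bigr => j _; rewrite /= tmapE trunitE scalerA.
split=> i j.
  (* Contracting the last factor of (Delta (x) 1) Delta(c_i) by psi_j isolates
     Delta(D_ij). *)
  pose H : {linear tens (tens C C) C -> tens C C} := tmap idfun (evr (psi j)) \o @tassoc k C C C.
  have HE s d : H (tpure s d) = (psi j d : k) *: s.
    elim/tens_ind: s => [|v w s IH]; first by rewrite tpure0l linear0 scaler0.
    by rewrite tpureDl linearD scalerDr -IH; congr (_ + _); rewrite /= tassocE tmapE /= evrE tpureZr.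
  have := congr1 (tmap idfun (evr (psi j))) (comulA (c i)).
  rewrite cD !linear_sum => e.
  transitivity (\sum_l H (tpure (comul (D i l)) (c l))).
    rewrite -[LHS](dual_sum (fun l => comul (D i l)) j dual).
    by apply: eq_bigr => l' _; rewrite HE.
  transitivity (\sum_l tmap idfun (evr (psi j))
      (tassoc (tmap comul idfun (tpure (D i l) (c l))))).
    by apply: eq_bigr => l' _; rewrite /H /= tmapE.
  rewrite [LHS]e; apply: eq_bigr => l' _; rewrite /= !tmapE /= cD linear_sum.
  rewrite -[RHS](dual_sum (fun n => tpure (D i l') (D l' n)) j dual) tpure_sumr.
  by apply: eq_bigr => n _; rewrite /= evrE tpureZr.
have := congr1 (psi j) (counitl (c i)); rewrite cD !linear_sum dual eq_sym => <-.
rewrite -[LHS](dual_sum (fun l => counit (D i l)) j dual).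
by apply: eq_bigr => l' _; rewrite /= tmapE tlunitE linearZ /= [LHS]mulrC.
Qed.

(** * Exchanging the two factors of B oslash B *)

Section OslashAction.
Variables (k : fieldType) (B : bialgType k).
Local Notation X := (oslash B).
Implicit Types (s t : tens B B) (q : X) (a b c w x y z : B).

Fact oact_subproof s u : u \in Defs.span (@oslash_gen k B) -> opi (s * u) = 0.
Proof.
move: u; apply: (@span_ind k _ _ (fun u => opi (s * u) = 0)) => [|e u v IHu IHv|_ [t [b [b0 ->]]]].
- by rewrite mulr0 linear0.
- by rewrite mulrDr tens_scaleAr linearP /= IHu IHv scaler0 addr0.
- by rewrite mulrA opi_mul_comul b0 scale0r.
Qed.

Fact opi_mull_linear s : linear (fun t => opi (s * t)).
Proof. by move=> e t u; rewrite mulrDr tens_scaleAr linearP. Qed.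
(** Left multiplication by s preserves the left ideal defining X, so it induces
    the action [oact] of the algebra B (x) B on X. *)
Definition opi_mull s : tens B B -> X := fun t => opi (s * t).
HB.instance Definition _ s :=
  GRing.isLinear.Build k (tens B B) X _ (opi_mull s) (opi_mull_linear s).

Definition oact s : X -> X := lquot_lift (f := opi_mull s) (oact_subproof s).
Fact oact_linear s : linear (oact s). Proof. exact: linearP. Qed.
HB.instance Definition _ s := GRing.isLinear.Build k X X _ (oact s) (oact_linear s).

Lemma oactE s t : oact s (opi t) = opi (s * t).
Proof. exact: lquot_liftE. Qed.

Lemma oact_ocls a b x y : oact (tpure a b) (ocls x y) = ocls (a * x) (b * y).
Proof. by rewrite /ocls oactE tensM. Qed.

Lemma oactA s t q : oact s (oact t q) = oact (s * t) q.
Proof. by have [u <-] := opi_onto q; rewrite !oactE mulrA. Qed.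

Lemma oactPl e s t q : oact (e *: s + t) q = e *: oact s q + oact t q.
Proof.
by have [u <-] := opi_onto q; rewrite !oactE mulrDl tens_scaleAl linearP.
Qed.

Lemma iBM a b : iB (a * b) = oact (tpure a 1) (iB b).
Proof. by rewrite /iB oact_ocls mul1r. Qed.

Lemma ocls_oact2 x y : ocls x y = oact (tpure 1 y) (iB x).
Proof. by rewrite oact_ocls mul1r mulr1. Qed.

Lemma sum_ocls c : \sum_(p <- swd c) ocls p.1 p.2 = (counit c : k) *: ocls 1 1.
Proof. by rewrite -ocls_sw; apply: eq_bigr => p _; rewrite !mul1r. Qed.

Lemma iB_coalg_map : is_coalg_map (@iB k B).
Proof.
split=> x; last by rewrite [LHS]ocounitE counit1 mulr1.
rewrite [LHS]ocomulE [in RHS]swdE linear_sum; apply: eq_bigr => p _; rewrite /= tmapE.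
pose f (u v : B) : tens X X := tpure (ocls p.1 v) (ocls p.2 u).
have fbil : bilin f by split=> *; rewrite /f oclsPr ?tpurePl ?tpurePr.
by rewrite -(sw_lift fbil) comul1 tliftE.
Qed.

Fact oshift_subproof :
  bilin (fun q y => \sum_(r <- swd y) tpure (oact (tpure 1 r.1) q) r.2).
Proof.
split=> [y e q q'|q].
  rewrite scaler_sumr -big_split; apply: eq_bigr => r _ /=.
  by rewrite linearP tpurePl.
apply: (@sw_linear k B _ (fun u v => tpure (oact (tpure 1 u) q) v)).
split=> [w e v v'|v e w w']; last by rewrite tpurePr.
by rewrite tpurePr oactPl tpurePl.
Qed.
(** q (x) y |-> y_1.q (x) y_2, where B acts on X through the second factor. *)
Definition oshift : tens X B -> tens X B := tlift oshift_subproof.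
HB.instance Definition _ := GRing.Linear.on oshift.

(** c_1 / c_2 (x) c_3 = 1 / 1 (x) c, by the defining relations of X. *)
Lemma oshift_comul c : oshift (tmap (@iB k B) idfun (comul c)) = tpure (ocls 1 1) c.
Proof.
transitivity (\sum_(p <- swd c) \sum_(r <- swd p.2) tpure (ocls p.1 r.1) r.2).
  rewrite [in LHS]swdE !linear_sum; apply: eq_bigr => p _.
  rewrite /= tmapE /oshift tliftE; apply: eq_bigr => r _.
  by rewrite /= -ocls_oact2.
rewrite -(sw_assoc (F := fun u v w => tpure (ocls u v) w)); first last.
- by move=> ? ? ? ? ?; rewrite tpurePr.
- by move=> ? ? ? ? ?; rewrite oclsPr tpurePl.
- by move=> ? ? ? ? ?; rewrite oclsPl tpurePl.
under eq_bigr do rewrite -tpure_suml sum_ocls tpureZl -tpureZr.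
by rewrite -tpure_sumr sw_counitl.
Qed.

Lemma oshift_oact a (t : tens X B) :
  oshift (tmap (oact (tpure a 1)) idfun t) = tmap (oact (tpure a 1)) idfun (oshift t).
Proof.
elim/tens_ind: t => [|q y t IH]; first by rewrite !linear0.
rewrite !linearD /= {}IH; congr (_ + _).
rewrite tmapE /oshift !tliftE linear_sum; apply: eq_bigr => r _.
by rewrite /= tmapE /= oactA [in RHS]oactA !tensM !mulr1 !mul1r.
Qed.

(** If p D has entries in I then sum_j (p D)_j / 1 (x) c_j = 0. This is the image
    of sum_i p_i (x) Delta(c_i), so [oshift] maps it to sum_i p_i / 1 (x) c_i, and
    the c_i are independent. *)
Lemma iB_row_cancel m (c : 'I_m -> B) psi (D : 'M[B]_m) n (p : 'rV[B]_m) :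
  dual_family c psi ->
  (forall i, tmap (@iB k B) idfun (comul (c i)) = \sum_j tpure (iB (D i j)) (c j)) ->
  (forall j, iB ((p *m D ^+ n) 0 j) = 0) -> forall i, iB (p 0 i) = 0.
Proof.
move=> dual cD; elim: n => [|n IH] in p *; first by rewrite expr0 mulmx1.
rewrite exprS mulmxA => /IH pD0; apply: (dual_independent dual).
transitivity (oshift (\sum_j tpure (iB ((p *m D) 0 j)) (c j))); last first.
  by rewrite big1 ?linear0 // => j _; rewrite pD0 tpure0l.
under [in RHS]eq_bigr => j _ do rewrite mxE linear_sum tpure_suml.
rewrite exchange_big linear_sum; apply: eq_bigr => i _ /=.
transitivity (oshift (tmap (oact (tpure (p 0 i) 1)) idfun (tmap (@iB k B) idfun (comul (c i))))).
  by rewrite oshift_oact oshift_comul tmapE /= -iBM mulr1.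
congr (oshift _); rewrite cD linear_sum; apply: eq_bigr => j _.
by rewrite /= tmapE iBM.
Qed.

Lemma oshift_counit q y : evr (@counit k B) (oshift (tpure q y)) = oact (tpure 1 y) q.
Proof.
rewrite /oshift tliftE linear_sum -[y in RHS]sw_counitr tpure_sumr.
have [u <-] := opi_onto q; rewrite oactE mulr_suml linear_sum; apply: eq_bigr => p _.
by rewrite /= evrE oactE tpureZr tens_scaleAl linearZ.
Qed.

(** The second part is what makes the future antipode well defined on B/I. Both
    come from 1 / c_i = sum_j eps(c_j) s_ij / 1, since eps factors through i and
    i(c_j) = 0 as soon as i(z) = 0. *)
Lemma ocls1_iB z : right_perfect B ->
  (exists w : B, ocls 1 z = iB w) /\ (iB z = 0 -> ocls 1 z = 0).
Proof.
move=> perfB.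
have [m [c [psi [D [l [dual zE cD c0]]]]]] := comodule_coefficients z iB_coalg_map.
have [n [s sD]] := right_perfect_mx D perfB.
have sD1 i j : iB ((s *m D) i j) = iB (1%:M i j : B).
  apply/eqP; rewrite -subr_eq0 -linearB; apply/eqP.
  have := @iB_row_cancel m c psi D n (row i (s *m D - 1%:M)) dual cD _ j; rewrite !mxE; apply.
  move=> j'; rewrite -row_mul mulmxBl mul1mx -mulmxA -[D *m _](exprS D) -sD subrr.
  by rewrite !mxE linear0.
have sumD i : \sum_j ocls (D i j) (c j) = (counit (c i) : k) *: ocls 1 1.
  transitivity (evr (@counit k B) (oshift (\sum_j tpure (iB (D i j)) (c j)))).
    rewrite !linear_sum; apply: eq_bigr => j _.
    by rewrite /= oshift_counit -ocls_oact2.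
  by rewrite -cD oshift_comul evrE.
have cE i : ocls 1 (c i) = iB (\sum_j (counit (c j) : k) *: s i j).
  transitivity (\sum_j ocls ((s *m D) i j) (c j)).
    under [RHS]eq_bigr => j _ do rewrite ocls_oact2 sD1 -ocls_oact2.
    rewrite (bigD1 i) //= big1 ?addr0; last first.
      by move=> j ji; rewrite mxE eq_sym (negPf ji) /ocls tpure0l linear0.
    by rewrite mxE eqxx.
  under eq_bigr do rewrite mxE ocls_suml.
  rewrite exchange_big linear_sum; apply: eq_bigr => j _ /=.
  rewrite linearZ /= -[s i j in RHS]mulr1 iBM -linearZ -sumD linear_sum.
  by apply: eq_bigr => j' _; rewrite /= oact_ocls mul1r.
have zw : ocls 1 z = iB (\sum_i l i *: \sum_j (counit (c j) : k) *: s i j).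
  rewrite [in LHS]zE ocls_sumr [RHS]linear_sum; apply: eq_bigr => i _.
  by rewrite oclsZr cE [RHS]linearZ.
split=> [|z0]; first by rewrite zw; eexists.
rewrite zw big1 ?linear0 // => i _; rewrite big1 ?scaler0 // => j _.
by rewrite -(iB_coalg_map.2 (c j)) c0 // linear0 scale0r.
Qed.
End OslashAction.

Section Swap.
Variables (k : fieldType) (V W : lmodType k).
Fact tswap_subproof : bilin (fun (v : V) (w : W) => tpure w v).
Proof. by split=> *; rewrite ?tpurePl ?tpurePr. Qed.
Definition tswap : tens V W -> tens W V := tlift tswap_subproof.
HB.instance Definition _ := GRing.Linear.on tswap.
Lemma tswapE v w : tswap (tpure v w) = tpure w v.
Proof. exact: tliftE. Qed.
End Swap.
Arguments tswap {k V W} _ : simpl never.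

Lemma tswapM (k : fieldType) (A : algType k) (s t : tens A A) :
  tswap (s * t) = tswap s * tswap t.
Proof.
elim/tens_ind: s => [|a b s IH]; first by rewrite !(mul0r, linear0).
rewrite mulrDl !linearD /= mulrDl {}IH; congr (_ + _).
elim/tens_ind: t => [|c d t IH]; first by rewrite !(mulr0, linear0).
by rewrite mulrDr !linearD /= mulrDr {}IH tensM !tswapE tensM.
Qed.

(** The co-opposite bialgebra, with the same product and the flipped coproduct. *)
Definition coop (B : Type) : Type := B.

Section Coop.
Variables (k : fieldType) (B : bialgType k).
Local Notation C := (coop B).
HB.instance Definition _ := GRing.Algebra.on C.

Definition coop_comul : C -> tens C C := fun x => tswap (comul (x : B)).
Fact coop_comul_linear : linear coop_comul.
Proof. by move=> a x y; rewrite /coop_comul !linearP. Qed.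
HB.instance Definition _ :=
  GRing.isLinear.Build k C (tens C C) _ coop_comul coop_comul_linear.
Definition coop_counit : C -> k^o := fun x => counit (x : B).
Fact coop_counit_linear : linear coop_counit.
Proof. by move=> a x y; rewrite /coop_counit linearP. Qed.
HB.instance Definition _ :=
  GRing.isLinear.Build k C k^o _ coop_counit coop_counit_linear.

Lemma coop_comulE x : coop_comul x = \sum_(p <- swd (x : B)) tpure (p.2 : C) (p.1 : C).
Proof.
rewrite /coop_comul swdE linear_sum; apply: eq_bigr => p _; exact: tswapE.
Qed.

Fact coop_comulA x : tassoc (tmap coop_comul idfun (coop_comul x)) =
  tmap idfun coop_comul (coop_comul x).
Proof.
transitivity (\sum_(p <- swd (x : B)) \sum_(q <- swd p.2)
    tpure (q.2 : C) (tpure (q.1 : C) (p.1 : C))).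
  rewrite coop_comulE !linear_sum; apply: eq_bigr => p _.
  rewrite /= tmapE /= coop_comulE tpure_suml linear_sum; apply: eq_bigr => q _.
  exact: tassocE.
rewrite -(sw_assoc (F := fun u v w : B => tpure (w : C) (tpure (v : C) (u : C)))).
- rewrite coop_comulE !linear_sum; apply: eq_bigr => p _.
  by rewrite /= tmapE /= coop_comulE tpure_sumr.
- by move=> ? ? ? ? ?; rewrite !tpurePr.
- by move=> ? ? ? ? ?; rewrite tpurePl tpurePr.
- by move=> ? ? ? ? ?; rewrite tpurePl.
Qed.
Fact coop_counitl x : tlunit (tmap coop_counit idfun (coop_comul x)) = x.
Proof.
rewrite coop_comulE !linear_sum -[RHS](@sw_counitr k B); apply: eq_bigr => p _.
by rewrite /= tmapE tlunitE.
Qed.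
Fact coop_counitr x : trunit (tmap idfun coop_counit (coop_comul x)) = x.
Proof.
rewrite coop_comulE !linear_sum -[RHS](@sw_counitl k B); apply: eq_bigr => p _.
by rewrite /= tmapE trunitE.
Qed.
HB.instance Definition _ :=
  isCoalgebra.Build k C coop_comulA coop_counitl coop_counitr.

Fact coop_comulM (x y : C) : (comul (x * y) : tens C C) = comul x * comul y.
Proof. by rewrite -tswapM -comulM. Qed.
Fact coop_comul1 : comul (1 : C) = 1 :> tens C C.
Proof. by rewrite [LHS](congr1 (@tswap k B B) (@comul1 k B)) [LHS]tswapE. Qed.
HB.instance Definition _ := isBialgebra.Build k C
  coop_comulM coop_comul1 (@counitM k B) (@counit1 k B).

(** The flip x / y |-> y / x from the X of the co-opposite bialgebra to that of B. *)
Definition oflip0 : tens C C -> oslash B := fun t => opi (tswap t : tens B B).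
Fact oflip0_linear : linear oflip0.
Proof. by move=> a s t; rewrite /oflip0 !linearP. Qed.
HB.instance Definition _ :=
  GRing.isLinear.Build k (tens C C) (oslash B) _ oflip0 oflip0_linear.

Fact oflip_subproof u : u \in Defs.span (@oslash_gen k C) -> oflip0 u = 0.
Proof.
move: u; apply: (@span_lker k _ _ _ oflip0) => _ [t [b [b0 ->]]].
rewrite /= /oflip0 tswapM.
have -> : tswap (comul b) = comul (b : B).
  rewrite [comul b](@coop_comulE b) linear_sum [RHS]swdE.
  by apply: eq_bigr => p _; exact: tswapE.
by rewrite opi_mul_comul [counit (b : B)]b0 scale0r.
Qed.

Lemma iB_ocls1 (z : B) : right_perfect B -> exists w, iB z = ocls 1 w.
Proof.
move=> perfB; have [[w zw] _] := @ocls1_iB k C z perfB.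
have h (x y : C) : lquot_lift oflip_subproof (ocls x y) = ocls (y : B) (x : B).
  by rewrite [LHS]lquot_liftE /= /oflip0 tswapE.
by exists w; rewrite -[LHS]h zw [LHS]h.
Qed.
End Coop.

(** * The Hopf quotient and its universal property *)

(** Linear identities on a coalgebra need only be checked on comatrix elements. *)
Lemma comatrix_ext (k : fieldType) (C : coalgType k) (U : lmodType k)
    (f g : {linear C -> U}) :
  (forall (m : nat) (D : 'M[C]_m), comatrix D -> forall i j, f (D i j) = g (D i j)) -> f =1 g.
Proof.
move=> fg x; have [m [D [l [r [comD ->]]]]] := comatrix_span x.
rewrite !linear_sum; apply: eq_bigr => i _; rewrite !linear_sum; apply: eq_bigr => j _.
by rewrite !linearZ fg.
Qed.

Lemma comatrix_map (k : fieldType) (C E : coalgType k) (g : {linear C -> E}) m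
    (D : 'M[C]_m) : is_coalg_map g -> comatrix D -> comatrix (map_mx g D).
Proof.
move=> [g_comul g_counit] [D_comul D_counit]; split=> i j; rewrite mxE ?g_counit //.
rewrite g_comul D_comul linear_sum; apply: eq_bigr => l _.
by rewrite /= tmapE !mxE.
Qed.

(** On comatrix elements the convolution product is the matrix product. *)
Lemma convolution_mx (k : fieldType) (C : coalgType k) (A : algType k)
    (f g : {linear C -> A}) m (D : 'M[C]_m) i j : comatrix D ->
  mulmap (tmap f g (comul (D i j))) = (map_mx f D *m map_mx g D) i j.
Proof.
move=> [D_comul _]; rewrite D_comul !linear_sum mxE; apply: eq_bigr => l _.
by rewrite /= tmapE mulmapE !mxE.
Qed.

Lemma comatrix_counit (k : fieldType) (C : coalgType k) (A : algType k) m
    (D : 'M[C]_m) : comatrix D -> \matrix_(i, j) ((counit (D i j) : k) *: (1 : A)) = 1%:M.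
Proof.
move=> [_ D_counit]; apply/matrixP => i j; rewrite !mxE D_counit.
by case: eqP; rewrite ?scale1r ?scale0r.
Qed.

Lemma antipode_mx (k : fieldType) (H : bialgType k) (S : {linear H -> H}) m (D : 'M[H]_m) :
  is_antipode S -> comatrix D ->
  map_mx S D *m D = 1%:M /\ D *m map_mx S D = 1%:M.
Proof.
move=> antiS comD; rewrite -(comatrix_counit H comD).
have mapid : map_mx idfun D = D by apply/matrixP => i j; rewrite mxE.
split; apply/matrixP => i j; have [Sid idS] := antiS (D i j).
  by rewrite [RHS]mxE -Sid convolution_mx // mapid.
by rewrite [RHS]mxE -idS convolution_mx // mapid.
Qed.

(** Multiplying a^n = s a^(n+1) by b^n on the right gives s a = 1. *)
Lemma right_inverse_left_inverse (R : pzRingType) (a b s : R) n :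
  a * b = 1 -> a ^+ n = s * a ^+ n.+1 -> b * a = 1.
Proof.
move=> ab asn; have abn : a ^+ n * b ^+ n = 1.
  elim: n {asn} => [|n IH]; first by rewrite mulr1.
  by rewrite exprSr exprS -mulrA (mulrA a) ab mul1r.
have sa : s * a = 1 by rewrite -[RHS]abn asn exprS -!mulrA abn mulr1.
by have -> : b = s by rewrite -[b]mul1r -sa -mulrA ab mulr1.
Qed.

(** For a comatrix D, the hypothesis says that S(D) is a right inverse of D. *)
Lemma right_antipode_antipode (k : fieldType) (H : bialgType k) (S : {linear H -> H}) :
  right_perfect H ->
  (forall x, mulmap (tmap idfun S (comul x)) = (counit x : k) *: 1) -> is_antipode S.
Proof.
move=> perfH antiS x; split=> //; move: x.
have elin : linear (fun x : H => (counit x : k) *: (1 : H)).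
  by move=> a x y; rewrite linearP scalerDl -scalerA.
pose el : {linear H -> H} := HB.pack (fun x : H => (counit x : k) *: (1 : H))
  (GRing.isLinear.Build k H H _ (fun x : H => (counit x : k) *: (1 : H)) elin).
pose cl : {linear H -> H} := @mulmap k H \o tmap S idfun \o comul.
apply: (comatrix_ext (f := cl) (g := el)) => m D comD i j.
have mapid : map_mx idfun D = D by apply/matrixP => ? ?; rewrite mxE.
have [n [s sD]] := right_perfect_mx D perfH.
have DS : D *m map_mx S D = 1%:M.
  rewrite -(comatrix_counit H comD); apply/matrixP => i' j'.
  by rewrite [RHS]mxE -antiS convolution_mx // mapid.
have SD : map_mx S D *m D = 1%:M by exact: right_inverse_left_inverse DS sD.
rewrite /cl /el /= convolution_mx // mapid SD -(comatrix_counit H comD).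
by rewrite mxE.
Qed.

(** Both g(S(D)) and T(g(D)) are inverse to the matrix g(D). *)
Lemma coalg_map_antipode (k : fieldType) (H K : bialgType k) (S : {linear H -> H})
    (T : {linear K -> K}) (g : {lrmorphism H -> K}) :
  is_antipode S -> is_antipode T -> is_coalg_map g -> forall x, g (S x) = T (g x).
Proof.
move=> antiS antiT cg.
apply: (comatrix_ext (f := g \o S) (g := T \o g)) => m D comD i j.
have [SD _] := antipode_mx antiS comD.
have [_ DT] := antipode_mx antiT (comatrix_map cg comD).
have gSD : map_mx g (map_mx S D) *m map_mx g D = 1%:M.
  by rewrite -map_mxM SD map_mx1.
have : map_mx g (map_mx S D) = map_mx T (map_mx g D).
  by rewrite -[LHS]mulmx1 -DT mulmxA gSD mul1mx.
by move=> /matrixP/(_ i j); rewrite !mxE.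
Qed.

Section AntipodeShift.
Variables (k : fieldType) (K : bialgType k) (T : {linear K -> K}).
Hypothesis antiT : is_antipode T.

Fact mul_antipode_subproof (y : K) : bilin (fun u v : K => u * T (y * v)).
Proof.
split=> [w a v v'|v a w w'] /=; first by rewrite mulrDl scalerAl.
by rewrite mulrDr -scalerAr linearP mulrDr scalerAr.
Qed.

(** In Sweedler notation, b_1 T(y b_2) = T(y_1) y_2 b_1 T(y_3 b_2)
    = T(y_1) eps(y_2 b) = eps(b) T(y). It replaces the antimultiplicativity of T
    in the proof that x / y |-> f(x) T(f(y)) is well defined. *)
Lemma comatrix_shift m n (D : 'M[K]_m) (E : 'M[K]_n) i j a b :
  comatrix D -> comatrix E ->
  \sum_l D a l * T (E i j * D l b) = (counit (D a b) : k) *: T (E i j).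
Proof.
move=> comD comE; have [TE _] := antipode_mx antiT comE.
transitivity (\sum_p T (E i p) * mulmap (tmap idfun T (comul (E p j * D a b)))).
  have TEi q : \sum_p T (E i p) * E p q = (i == q)%:R.
    have := congr1 (fun M : 'M_n => M i q) TE; rewrite !mxE => <-.
    by apply: eq_bigr => p _; rewrite mxE.
  transitivity (\sum_p \sum_q \sum_l T (E i p) * E p q * (D a l * T (E q j * D l b))).
    rewrite exchange_big (bigD1 i) //= [X in _ + X]big1 ?addr0 => [|q qi].
      rewrite exchange_big; apply: eq_bigr => l _.
      by rewrite -mulr_suml TEi eqxx mul1r.
    rewrite exchange_big big1 // => l _.
    by rewrite -mulr_suml TEi eq_sym (negPf qi) mul0r.
  apply: eq_bigr => p _; rewrite comulM (comE.1 p j) (comD.1 a b).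
  rewrite mulr_suml !linear_sum mulr_sumr; apply: eq_bigr => q _.
  rewrite mulr_sumr !linear_sum mulr_sumr; apply: eq_bigr => l _.
  by rewrite /= tensM tmapE mulmapE !mulrA.
transitivity (\sum_p (counit (E p j) * counit (D a b) : k) *: T (E i p)).
  by apply: eq_bigr => p _; rewrite (antiT _).2 counitM -scalerAr mulr1.
rewrite (bigD1 j) //= big1 ?addr0 => [|p pj]; first by rewrite comE.2 eqxx mul1r.
by rewrite comE.2 (negPf pj) mul0r scale0r.
Qed.

Lemma mul_antipode_comul y b :
  tlift (mul_antipode_subproof y) (comul b) = (counit b : k) *: T y.
Proof.
have ylin (t : tens K K) : linear (fun y => tlift (mul_antipode_subproof y) t).
  move=> a u v; have [|h _] := @bilin_tlift _ _ _ K K _ mul_antipode_subproof.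
    by move=> v' w e u1 u2; rewrite mulrDl -scalerAl linearP mulrDr -scalerAr.
  exact: h.
have glin : linear (fun b : K => (counit b : k) *: T y).
  by move=> a u v; rewrite linearP scalerDl -scalerA.
pose f : {linear K -> K} := tlift (mul_antipode_subproof y) \o comul.
pose g : {linear K -> K} := HB.pack (fun b : K => (counit b : k) *: T y)
  (GRing.isLinear.Build k K K _ (fun b : K => (counit b : k) *: T y) glin).
apply: (comatrix_ext (f := f) (g := g)) => m D comD a c; rewrite /f /g /= {f g glin b}.
pose f : {linear K -> K} := HB.pack (fun y => tlift (mul_antipode_subproof y) (comul (D a c)))
  (GRing.isLinear.Build k K K _ (fun y => tlift (mul_antipode_subproof y) (comul (D a c)))
     (ylin _)).
apply: (comatrix_ext (f := f) (g := (counit (D a c) : k) \*: T)) => n E comE i j.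
rewrite /f /= -comatrix_shift // (comD.1 a c) linear_sum; apply: eq_bigr => l _.
by rewrite /= tliftE.
Qed.

End AntipodeShift.

Lemma antipode1 (k : fieldType) (K : bialgType k) (T : {linear K -> K}) :
  is_antipode T -> T 1 = 1.
Proof.
move=> /(_ 1)[]; rewrite comul1 tmapE mulmapE /= mulr1 => -> _.
by rewrite counit1 scale1r.
Qed.

Section KernelOfCoalgMaps.
Variables (k : fieldType) (B K : bialgType k) (T : {linear K -> K}).
Variable f : {lrmorphism B -> K}.
Hypotheses (antiT : is_antipode T) (cf : is_coalg_map f).

Fact oslash_hopf_subproof0 : bilin (fun x y : B => f x * T (f y)).
Proof.
split=> [w a v v'|v a w w'] /=; first by rewrite linearP mulrDl scalerAl.
by rewrite !linearP mulrDr scalerAr.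
Qed.

Fact oslash_hopf_subproof u : u \in Defs.span (@oslash_gen k B) ->
  tlift oslash_hopf_subproof0 u = 0.
Proof.
move: u; apply: (@span_lker k _ _ _ (tlift oslash_hopf_subproof0)) => _ [t [b [b0 ->]]].
elim/tens_ind: t => [|x y t IH]; first by rewrite mul0r linear0.
rewrite mulrDl linearD /= {}IH addr0.
transitivity (f x * tlift (mul_antipode_subproof T (f y)) (comul (f b))).
  rewrite cf.1 [in LHS]swdE mulr_sumr [in RHS]swdE !linear_sum mulr_sumr.
  by apply: eq_bigr => p _; rewrite /= tensM tmapE !tliftE !rmorphM mulrA.
by rewrite mul_antipode_comul // cf.2 b0 scale0r mulr0.
Qed.

(** The map x / y |-> f(x) T(f(y)) sends i(b) to f(b). *)
Lemma iB_eq0_hopf b : iB b = 0 -> f b = 0.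
Proof.
move=> /(congr1 (lquot_lift oslash_hopf_subproof)); rewrite linear0 => <-.
by rewrite [RHS]lquot_liftE /= tliftE rmorph1 antipode1 // mulr1.
Qed.
End KernelOfCoalgMaps.

Section HopfQuotient.
Variables (k : fieldType) (B : bialgType k).
Hypothesis perfB : right_perfect B.
Local Notation I := (kerl (@iB k B)).

Lemma mem_kerl (V W : lmodType k) (f : {linear V -> W}) x : x \in kerl f <-> f x = 0.
Proof. by rewrite unfold_in; split=> /eqP. Qed.

(** Closure under right multiplication by a uses a / 1 = 1 / w: for x in I,
    xa / 1 = x / w is the image of x / 1 under the action of w. *)
Lemma iB_biideal : biideal I.
Proof.
split=> [a x|a x|x|x] /mem_kerl /= ix.
- by apply/mem_kerl; rewrite /= iBM ix linear0.
- apply/mem_kerl; have [w aw] := iB_ocls1 a perfB.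
  by rewrite /= iBM aw oact_ocls mulr1 mul1r ocls_oact2 ix linear0.
- have := @tmap_ker k B (oslash B) (@iB k B) (comul x).
  rewrite -(iB_coalg_map B).1 /= ix linear0 => /(_ erefl).
  congr (_ \in Defs.span _); apply/seteqP.
  split=> _ [y [z [yz ->]]]; exists y, z; split=> //.
    by case: yz => /mem_kerl; [left|right].
  by case: yz => /mem_kerl; [left|right].
- by rewrite -((iB_coalg_map B).2 x) /= ix linear0.
Qed.

Variable hI : biideal I.
Local Notation Q := (biquot hI).
Local Notation pi := (biquot_pi hI).

Fact iota_subproof x : x \in I -> iB x = 0. Proof. by move/mem_kerl. Qed.
Definition iota : Q -> oslash B := lquot_lift iota_subproof.
Fact iota_linear : linear iota. Proof. exact: linearP. Qed.
HB.instance Definition _ := GRing.isLinear.Build k Q (oslash B) _ iota iota_linear.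
Lemma iotaE b : iota (pi b) = iB b. Proof. exact: lquot_liftE. Qed.

Lemma iota_inj : injective iota.
Proof.
move=> p q; have [x <-] := biquot_pi_onto p; have [y <-] := biquot_pi_onto q.
rewrite !iotaE => xy; apply/biquot_pi_eq/mem_kerl.
by rewrite linearB /= xy subrr.
Qed.

Lemma iota_coalg_map : is_coalg_map iota.
Proof.
have [pi_comul pi_counit] := biquot_pi_coalg_map hI.
have [iB_comul iB_counit] := iB_coalg_map B.
split=> q; have [x <-] := biquot_pi_onto q; rewrite /= iotaE ?pi_counit ?iB_counit //.
rewrite iB_comul pi_comul; apply/esym/tmap_comp; exact: iotaE.
Qed.

Fact ocls1_linear : linear (ocls (1 : B)). Proof. by move=> a x y; rewrite oclsPr. Qed.
HB.instance Definition _ :=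
  GRing.isLinear.Build k B (oslash B) _ (ocls (1 : B)) ocls1_linear.

Fact jota_subproof x : x \in I -> ocls 1 x = 0.
Proof. by move/mem_kerl; exact: (ocls1_iB x perfB).2. Qed.
(** The map induced by z |-> 1 / z; the antipode is its factorisation through the
    injective map [iota]. *)
Definition jota : Q -> oslash B := lquot_lift jota_subproof.
Fact jota_linear : linear jota. Proof. exact: linearP. Qed.
HB.instance Definition _ := GRing.isLinear.Build k Q (oslash B) _ jota jota_linear.
Lemma jotaE b : jota (pi b) = ocls 1 b. Proof. exact: lquot_liftE. Qed.

(** For q the class of x, the right antipode identity reads
    x_1 / x_2 = eps(x) 1 / 1. *)
Lemma exists_antipode : exists S : {linear Q -> Q}, is_antipode S.
Proof.
have /choice[S hS] : forall q, exists q', iota q' = jota q.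
  move=> q; have [x <-] := biquot_pi_onto q; have [[w xw] _] := ocls1_iB x perfB.
  by exists (pi w); rewrite iotaE jotaE.
have Slin : linear S by move=> a p q; apply: iota_inj; rewrite hS !linearP /= !hS.
pose Sl : {linear Q -> Q} := HB.pack S (GRing.isLinear.Build k Q Q _ S Slin).
exists Sl; apply: right_antipode_antipode.
  by apply: (right_perfect_quotient (f := pi)) perfB => q; exact: biquot_pi_onto.
move=> q; have [x <-] := biquot_pi_onto q; apply: iota_inj.
have [pi_comul pi_counit] := biquot_pi_coalg_map hI.
have iotaM b p : iota (pi b * p) = oact (tpure b 1) (iota p).
  by have [y <-] := biquot_pi_onto p; rewrite -biquot_piM !iotaE iBM.
rewrite pi_comul pi_counit linearZ /= (_ : 1 = pi 1) ?rmorph1 // iotaE -sum_ocls.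
rewrite [in LHS]swdE !linear_sum; apply: eq_bigr => p _.
by rewrite /= !tmapE /= mulmapE iotaM hS jotaE oact_ocls mulr1 mul1r.
Qed.

Section Factor.
Variables (K : bialgType k) (T : {linear K -> K}) (f : {lrmorphism B -> K}).
Hypotheses (antiT : is_antipode T) (cf : is_coalg_map f).

Fact factor_subproof x : x \in I -> f x = 0.
Proof. by move/mem_kerl; exact: iB_eq0_hopf. Qed.
Definition factor : Q -> K := lquot_lift factor_subproof.
Fact factor_linear : linear factor. Proof. exact: linearP. Qed.
HB.instance Definition _ := GRing.isLinear.Build k Q K _ factor factor_linear.
Lemma factorE b : factor (pi b) = f b. Proof. exact: lquot_liftE. Qed.
Fact factor_monoid : monoid_morphism factor.
Proof.
split=> [|p q]; first by rewrite -(rmorph1 pi) factorE rmorph1.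
have [x <-] := biquot_pi_onto p; have [y <-] := biquot_pi_onto q.
by rewrite -rmorphM !factorE rmorphM.
Qed.
HB.instance Definition _ := GRing.isMonoidMorphism.Build Q K factor factor_monoid.

Lemma factor_coalg_map : is_coalg_map factor.
Proof.
have [pi_comul pi_counit] := biquot_pi_coalg_map hI.
split=> q; have [x <-] := biquot_pi_onto q; rewrite /= factorE ?pi_counit ?cf.2 //.
rewrite cf.1 pi_comul; apply/esym/tmap_comp; exact: factorE.
Qed.
End Factor.

Lemma hopf_envelope_quotient (S : {linear Q -> Q}) : is_antipode S -> is_hopf_envelope S pi.
Proof.
move=> antiS; split=> //; first exact: biquot_pi_coalg_map.
move=> K T f antiT cf; exists (factor antiT cf); split.
- split; first exact: factor_coalg_map.
  by apply: coalg_map_antipode => //; exact: factor_coalg_map.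
- exact: factorE.
- move=> g _ gE q; have [x <-] := biquot_pi_onto q.
  by rewrite gE /= factorE.
Qed.
End HopfQuotient.

Theorem mainTheorem1 (k : fieldType) (B : bialgType k)
    (hB : finite_dimensional B \/ right_perfect B) :
  exists hI : biideal (kerl (@iB k B)),
    (exists S : {linear biquot hI -> biquot hI},
        is_hopf_envelope S (biquot_pi hI)) /\
    (exists iota : {linear biquot hI -> oslash B},
        [/\ is_coalg_map iota,
            injective iota,
            range iota = range (@iB k B) &
            forall b : B, iota (biquot_pi hI b) = iB b]).
Proof.
have perfB : right_perfect B.
  by case: hB => //; exact: finite_dimensional_right_perfect.
have hI := iB_biideal perfB; exists hI; split.
  have [S antiS] := exists_antipode perfB hI.
  by exists S; exact: hopf_envelope_quotient.
exists (@iota k B hI); split.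
- exact: iota_coalg_map.
- exact: iota_inj.
- apply/seteqP; split=> _ [x _ <-]; last by exists (biquot_pi hI x) => //=; rewrite iotaE.
  by have [b <-] := biquot_pi_onto x; exists b => //=; rewrite iotaE.
- exact: iotaE.
Qed.
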